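(* Let $\mathcal F$ be a Frobenius category and $l\in\mathbb N$. The stable monomorphism category $\mathcal M_l=\underline{\mathrm{Mor}}^{\mathrm m}_l(\mathcal F)$ admits the following semiorthogonal decompositions, where $s,t\in\{0,\dots,l\}$: (a) $\left(\Gamma^{[s+1,l]},\Gamma^{[0,s]}\right)$ if $s<l$; (b) $\left(\Gamma^{[s,t]},\Delta^{[s,t+1]}\right)$ if $s\le t<l$; (c) $\left(\Delta^{[s-1,t]},\Gamma^{[s,t]}\right)$ if $0<s\le t$.
   Context: Conventions: all subcategories are full and additive, functors are additive, and $\mathbb N$ contains $0$. A Frobenius category $\mathcal F$ is an exact category with enough projectives and enough injectives in which projective and injective objects coincide; its stable category $\underline{\mathcal F}$ is triangulated. For an exact category $\mathcal E$ and $l\in\mathbb N$, $\mathrm{Mor}^{\mathrm m}_l(\mathcal E)$ is the category of chains $X=(X,\alpha)\colon X^0\xrightarrow{\alpha^0}X^1\xrightarrow{\alpha^1}\cdots\xrightarrow{\alpha^{l-1}}X^l$ of $l$ admissible monomorphisms in $\mathcal E$, with commutative ladders $(f^0,\dots,f^l)$ as morphisms; it is an exact category with the termwise exact structure. If $\mathcal F$ is Frobenius, so is $\mathrm{Mor}^{\mathrm m}_l(\mathcal F)$, and its projective-injectives are the chains of admissible monomorphisms with all terms projective in $\mathcal F$. Its stable category is denoted $\mathcal M_l=\underline{\mathrm{Mor}}^{\mathrm m}_l(\mathcal F)$. For $0\le s\le t\le l$: - $\Gamma^{[s,t]}\subseteq\mathcal M_l$ is the triangulated subcategory of all objects $X$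 such that $X^k$ is projective in $\mathcal F$ for every $k\in\{0,\dots,s-1,t+1,\dots,l\}$ (the kernel of the functor on stable categories induced by deleting the terms $X^s,\dots,X^t$ and composing the morphisms around them). - $\Delta^{[s,t]}\subseteq\mathcal M_l$ is the triangulated subcategory of all objects isomorphic in $\mathcal M_l$ to a chain with $X^s=\cdots=X^t$ and $\alpha^s,\dots,\alpha^{t-1}$ identities (the essential image of the functor $\mathcal M_{l-t+s}\to\mathcal M_l$ induced by repeating the term at position $s$, with identities, at positions $s,\dots,t$). A semiorthogonal decomposition of a triangulated category $\mathcal T$ is a pair $(\mathcal U,\mathcal V)$ of triangulated subcategories such that $\mathrm{Hom}_{\mathcal T}(\mathcal U,\mathcal V)=0$ and each $T\in\mathcal T$ fits into a distinguished triangle $U\to T\to V\to\Sigma U$ with $U\in\mathcal U$, $V\in\mathcal V$. *)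

(* Defs.v *)
From HB Require Import structures.
From mathcomp Require Import all_boot ssralg generic_quotient ring_quotient.
From mathcomp Require Import boolp.
Set Implicit Arguments.
Unset Strict Implicit.
Unset Printing Implicit Defensive.
Import GRing.Theory.
Local Open Scope ring_scope.

Declare Scope cat_scope.
Delimit Scope cat_scope with cat.
Open Scope cat_scope.

Record preaddcat := PreAddCat {
  obj :> Type;
  hom : obj -> obj -> zmodType;
  idm : forall X, hom X X;
  compm : forall X Y Z, hom Y Z -> hom X Y -> hom X Z;
  compmA : forall X Y Z T (h : hom Z T) (g : hom Y Z) (f : hom X Y),
    compm (compm h g) f = compm h (compm g f);
  comp1m : forall X Y (f : hom X Y), compm (idm Y) f = f;
  compm1 : forall X Y (f : hom X Y), compm f (idm X) = f;
  compDl : forall X Y Z (g g' : hom Y Z) (f : hom X Y),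
    compm (g + g') f = compm g f + compm g' f;
  compDr : forall X Y Z (g : hom Y Z) (f f' : hom X Y),
    compm g (f + f') = compm g f + compm g f' }.

Notation "X ~> Y" := (hom X Y) (at level 55) : cat_scope.
Notation "g ∘ f" := (compm g f) (at level 40, left associativity) : cat_scope.

Section PreAdd.
Variable C : preaddcat.
Implicit Types X Y Z T : C.

Definition is_zero X := idm X = 0.

Definition is_inverse X Y (f : X ~> Y) (g : Y ~> X) :=
  g ∘ f = idm X /\ f ∘ g = idm Y.

Definition is_iso X Y (f : X ~> Y) := exists g : Y ~> X, is_inverse f g.

Definition isomorphic X Y := exists f : X ~> Y, is_iso f.

Record biproduct X Y := Biproduct {
  bip_obj :> C;
  bip_inl : X ~> bip_obj;
  bip_inr : Y ~> bip_obj;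
  bip_fst : bip_obj ~> X;
  bip_snd : bip_obj ~> Y;
  bip_fst_inl : bip_fst ∘ bip_inl = idm X;
  bip_snd_inr : bip_snd ∘ bip_inr = idm Y;
  bip_fst_inr : bip_fst ∘ bip_inr = 0;
  bip_snd_inl : bip_snd ∘ bip_inl = 0;
  bip_sum : bip_inl ∘ bip_fst + bip_inr ∘ bip_snd = idm bip_obj }.

Definition is_kernel X Y Z (i : X ~> Y) (p : Y ~> Z) :=
  p ∘ i = 0 /\
  forall T (f : T ~> Y), p ∘ f = 0 -> exists! g : T ~> X, i ∘ g = f.

Definition is_cokernel X Y Z (p : Y ~> Z) (i : X ~> Y) :=
  p ∘ i = 0 /\
  forall T (f : Y ~> T), f ∘ i = 0 -> exists! g : Z ~> T, g ∘ p = f.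

Definition is_pushout X Y X' P (i : X ~> Y) (f : X ~> X')
    (g : Y ~> P) (j : X' ~> P) :=
  g ∘ i = j ∘ f /\
  forall T (y : Y ~> T) (x : X' ~> T), y ∘ i = x ∘ f ->
    exists! t : P ~> T, t ∘ g = y /\ t ∘ j = x.

Definition is_pullback Y Z Z' P (p : Y ~> Z) (f : Z' ~> Z)
    (g : P ~> Y) (q : P ~> Z') :=
  p ∘ g = f ∘ q /\
  forall T (y : T ~> Y) (z : T ~> Z'), p ∘ y = f ∘ z ->
    exists! t : T ~> P, g ∘ t = y /\ q ∘ t = z.

Lemma comp0l X Y Z (f : X ~> Y) : (0 : Y ~> Z) ∘ f = 0.
Proof. by apply: (addrI (0 ∘ f)); rewrite -compDl !addr0. Qed.

Lemma comp0r X Y Z (f : Y ~> Z) : f ∘ (0 : X ~> Y) = 0.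
Proof. by apply: (addrI (f ∘ 0)); rewrite -compDr !addr0. Qed.

Lemma compNl X Y Z (g : Y ~> Z) (f : X ~> Y) : (- g) ∘ f = - (g ∘ f).
Proof. by apply: (addrI (g ∘ f)); rewrite -compDl !subrr comp0l. Qed.

Lemma compNr X Y Z (g : Y ~> Z) (f : X ~> Y) : g ∘ (- f) = - (g ∘ f).
Proof. by apply: (addrI (g ∘ f)); rewrite -compDr !subrr comp0r. Qed.

Lemma compBl X Y Z (g g' : Y ~> Z) (f : X ~> Y) :
  (g - g') ∘ f = g ∘ f - g' ∘ f.
Proof. by rewrite compDl compNl. Qed.

Lemma compBr X Y Z (g : Y ~> Z) (f f' : X ~> Y) :
  g ∘ (f - f') = g ∘ f - g ∘ f'.
Proof. by rewrite compDr compNr. Qed.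

Lemma reassoc X Y Z (g : Y ~> Z) (f : X ~> Y) (h : X ~> Z) :
  g ∘ f = h -> forall T (x : T ~> X), g ∘ (f ∘ x) = h ∘ x.
Proof. by move=> <- T x; rewrite compmA. Qed.

Lemma reassoc2 X Y Y' Z (g : Y ~> Z) (f : X ~> Y) (g' : Y' ~> Z) (f' : X ~> Y') :
  g ∘ f = g' ∘ f' -> forall T (x : T ~> X), g ∘ (f ∘ x) = g' ∘ (f' ∘ x).
Proof. by move=> e T x; rewrite -!compmA e. Qed.

End PreAdd.

Arguments is_zero {C} X.
Arguments isomorphic {C} X Y.

Definition simpm := (compDl, compDr, compNl, compNr, comp0l, comp0r, comp1m,
  compm1, compmA).

Record addcat := AddCat {
  addcat_pre :> preaddcat;
  zero_ex : exists Z : addcat_pre, is_zero Z;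
  biproduct_ex : forall X Y : addcat_pre, inhabited (biproduct X Y) }.

(* Exact structures in the sense of Quillen: inflations and deflations are the
   admissible monomorphisms and epimorphisms. *)
Record exactcat := ExactCat {
  exact_add :> addcat;
  conflation : forall X Y Z : exact_add, X ~> Y -> Y ~> Z -> Prop;
  inflation := fun (X Y : exact_add) (i : X ~> Y) =>
    exists (Z : exact_add) (p : Y ~> Z), conflation i p;
  deflation := fun (Y Z : exact_add) (p : Y ~> Z) =>
    exists (X : exact_add) (i : X ~> Y), conflation i p;
  conf_kernel : forall X Y Z (i : X ~> Y) (p : Y ~> Z),
    conflation i p -> is_kernel i p;
  conf_cokernel : forall X Y Z (i : X ~> Y) (p : Y ~> Z),
    conflation i p -> is_cokernel p i;
  conf_isom : forall X Y Z X' Y' Z' (i : X ~> Y) (p : Y ~> Z)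
    (i' : X' ~> Y') (p' : Y' ~> Z') (a : X ~> X') (b : Y ~> Y') (c : Z ~> Z'),
    conflation i p -> is_iso a -> is_iso b -> is_iso c ->
    b ∘ i = i' ∘ a -> c ∘ p = p' ∘ b -> conflation i' p';
  inflation_id : forall X, inflation (idm X);
  deflation_id : forall X, deflation (idm X);
  inflation_comp : forall X Y Z (j : Y ~> Z) (i : X ~> Y),
    inflation i -> inflation j -> inflation (j ∘ i);
  deflation_comp : forall X Y Z (q : Y ~> Z) (p : X ~> Y),
    deflation p -> deflation q -> deflation (q ∘ p);
  inflation_pushout : forall X Y X' (i : X ~> Y) (f : X ~> X'), inflation i ->
    exists (P : exact_add) (g : Y ~> P) (j : X' ~> P),
      is_pushout i f g j /\ inflation j;
  deflation_pullback : forall Y Z Z' (p : Y ~> Z) (f : Z' ~> Z), deflation p ->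
    exists (P : exact_add) (g : P ~> Y) (q : P ~> Z'),
      is_pullback p f g q /\ deflation q }.

Section PreAddTheory.
Variable C : preaddcat.
Implicit Types X Y Z T : C.

Lemma kernel_mono X Y Z (i : X ~> Y) (p : Y ~> Z) T (f g : T ~> X) :
  is_kernel i p -> i ∘ f = i ∘ g -> f = g.
Proof.
move=> [pi0 u] e; have [|h [_ hu]] := u _ (i ∘ f).
  by rewrite -compmA pi0 comp0l.
by rewrite -(hu f erefl) -(hu g).
Qed.

Lemma kernel_mono0 X Y Z (i : X ~> Y) (p : Y ~> Z) T (f : T ~> X) :
  is_kernel i p -> i ∘ f = 0 -> f = 0.
Proof. by move=> k e; apply: (kernel_mono k); rewrite comp0r. Qed.

Lemma kernel_lift X Y Z (i : X ~> Y) (p : Y ~> Z) T (f : T ~> Y) :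
  is_kernel i p -> p ∘ f = 0 -> exists g : T ~> X, i ∘ g = f.
Proof. by move=> [_ u] /u [g [e _]]; exists g. Qed.

Lemma coker_epi X Y Z (i : X ~> Y) (p : Y ~> Z) T (f g : Z ~> T) :
  is_cokernel p i -> f ∘ p = g ∘ p -> f = g.
Proof.
move=> [pi0 u] e; have [|h [_ hu]] := u _ (f ∘ p).
  by rewrite compmA pi0 comp0r.
by rewrite -(hu f erefl) -(hu g).
Qed.

Lemma coker_epi0 X Y Z (i : X ~> Y) (p : Y ~> Z) T (f : Z ~> T) :
  is_cokernel p i -> f ∘ p = 0 -> f = 0.
Proof. by move=> k e; apply: (coker_epi k); rewrite comp0l. Qed.

Lemma coker_desc X Y Z (i : X ~> Y) (p : Y ~> Z) T (f : Y ~> T) :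
  is_cokernel p i -> f ∘ i = 0 -> exists g : Z ~> T, g ∘ p = f.
Proof. by move=> [_ u] /u [g [e _]]; exists g. Qed.

Lemma is_iso_id X : is_iso (idm X).
Proof. by exists (idm X); split; rewrite comp1m. Qed.

Lemma is_iso_comp X Y Z (g : Y ~> Z) (f : X ~> Y) :
  is_iso f -> is_iso g -> is_iso (g ∘ f).
Proof.
move=> [f' [a b]] [g' [c d]]; exists (f' ∘ g'); split; rewrite !compmA.
  by rewrite (reassoc c) comp1m.
by rewrite (reassoc b) comp1m.
Qed.

Lemma kernel_uniq X X' Y Z (i : X ~> Y) (i' : X' ~> Y) (p : Y ~> Z) :
  is_kernel i p -> is_kernel i' p -> exists a : X ~> X', is_iso a /\ i' ∘ a = i.
Proof.
move=> k k'; have [a ea] := kernel_lift k' k.1.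
have [b eb] := kernel_lift k k'.1.
exists a; split=> //; exists b; split.
  by apply: (kernel_mono k); rewrite -compmA eb ea compm1.
by apply: (kernel_mono k'); rewrite -compmA ea eb compm1.
Qed.

Lemma coker_uniq X Y Z Z' (i : X ~> Y) (p : Y ~> Z) (p' : Y ~> Z') :
  is_cokernel p i -> is_cokernel p' i ->
  exists a : Z ~> Z', is_iso a /\ a ∘ p = p'.
Proof.
move=> k k'; have [a ea] := coker_desc k k'.1.
have [b eb] := coker_desc k' k.1.
exists a; split=> //; exists b; split.
  by apply: (coker_epi k); rewrite compmA ea eb comp1m.
by apply: (coker_epi k'); rewrite compmA eb ea comp1m.
Qed.

Lemma pushout_epi X Y X' P (i : X ~> Y) (f : X ~> X') (g : Y ~> P) (j : X' ~> P)
    T (s t : P ~> T) :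
  is_pushout i f g j -> s ∘ g = t ∘ g -> s ∘ j = t ∘ j -> s = t.
Proof.
move=> [e u] e1 e2; have [|h [_ hu]] := u _ (s ∘ g) (s ∘ j).
  by rewrite compmA e -compmA.
by rewrite -(hu s) // -(hu t).
Qed.

Lemma pushout_desc X Y X' P (i : X ~> Y) (f : X ~> X') (g : Y ~> P) (j : X' ~> P)
    T (y : Y ~> T) (x : X' ~> T) :
  is_pushout i f g j -> y ∘ i = x ∘ f ->
  exists t : P ~> T, t ∘ g = y /\ t ∘ j = x.
Proof. by move=> [_ u] /u [t [h _]]; exists t. Qed.

Lemma pushout_sym X Y X' P (i : X ~> Y) (f : X ~> X') (g : Y ~> P) (j : X' ~> P) :
  is_pushout i f g j -> is_pushout f i j g.
Proof.
move=> [e u]; split=> [//|T y x h].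
have [//|t [[a b] c]] := u T x y; exists t; split=> // t' [? ?].
exact: c.
Qed.

Lemma pushout_uniq X Y X' P P' (i : X ~> Y) (f : X ~> X') (g : Y ~> P)
    (j : X' ~> P) (g' : Y ~> P') (j' : X' ~> P') :
  is_pushout i f g j -> is_pushout i f g' j' ->
  exists a : P ~> P', [/\ is_iso a, a ∘ g = g' & a ∘ j = j'].
Proof.
move=> k k'; have [a [e1 e2]] := pushout_desc k k'.1.
have [b [e3 e4]] := pushout_desc k' k.1.
exists a; split=> //; exists b; split.
  by apply: (pushout_epi k); rewrite !compmA ?e1 ?e2 comp1m.
by apply: (pushout_epi k'); rewrite !compmA ?e3 ?e4 comp1m.
Qed.

Lemma pullback_mono Y Z Z' P (p : Y ~> Z) (f : Z' ~> Z) (g : P ~> Y)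
    (q : P ~> Z') T (s t : T ~> P) :
  is_pullback p f g q -> g ∘ s = g ∘ t -> q ∘ s = q ∘ t -> s = t.
Proof.
move=> [e u] e1 e2; have [|h [_ hu]] := u _ (g ∘ s) (q ∘ s).
  by rewrite -compmA e compmA.
by rewrite -(hu s) // -(hu t).
Qed.

Lemma pullback_lift Y Z Z' P (p : Y ~> Z) (f : Z' ~> Z) (g : P ~> Y)
    (q : P ~> Z') T (y : T ~> Y) (z : T ~> Z') :
  is_pullback p f g q -> p ∘ y = f ∘ z ->
  exists t : T ~> P, g ∘ t = y /\ q ∘ t = z.
Proof. by move=> [_ u] /u [t [h _]]; exists t. Qed.

Lemma zero_from X T (f : X ~> T) : is_zero X -> f = 0.
Proof. by move=> z; rewrite -[f]compm1 z comp0r. Qed.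

Lemma zero_to X T (f : T ~> X) : is_zero X -> f = 0.
Proof. by move=> z; rewrite -[f]comp1m z comp0l. Qed.

Definition bcopair X Y (B : biproduct X Y) T (f : X ~> T) (g : Y ~> T) : B ~> T :=
  f ∘ bip_fst B + g ∘ bip_snd B.

Definition bpair X Y (B : biproduct X Y) T (f : T ~> X) (g : T ~> Y) : T ~> B :=
  bip_inl B ∘ f + bip_inr B ∘ g.

Section Bip.
Variables (X Y : C) (B : biproduct X Y).
Lemma copair_inl T (f : X ~> T) (g : Y ~> T) : bcopair B f g ∘ bip_inl B = f.
Proof. by rewrite !simpm bip_fst_inl bip_snd_inl !simpm addr0. Qed.
Lemma copair_inr T (f : X ~> T) (g : Y ~> T) : bcopair B f g ∘ bip_inr B = g.
Proof. by rewrite !simpm bip_fst_inr bip_snd_inr !simpm add0r. Qed.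
Lemma fst_pair T (f : T ~> X) (g : T ~> Y) : bip_fst B ∘ bpair B f g = f.
Proof. by rewrite compDr -!compmA bip_fst_inl bip_fst_inr !simpm addr0. Qed.
Lemma snd_pair T (f : T ~> X) (g : T ~> Y) : bip_snd B ∘ bpair B f g = g.
Proof. by rewrite compDr -!compmA bip_snd_inl bip_snd_inr !simpm add0r. Qed.
Lemma copair_pair T U (f : X ~> T) (g : Y ~> T) (f' : U ~> X) (g' : U ~> Y) :
  bcopair B f g ∘ bpair B f' g' = f ∘ f' + g ∘ g'.
Proof. by rewrite compDl !compmA fst_pair snd_pair. Qed.
Lemma comp_copair T U (f : X ~> T) (g : Y ~> T) (h : T ~> U) :
  h ∘ bcopair B f g = bcopair B (h ∘ f) (h ∘ g).
Proof. by rewrite /bcopair !simpm. Qed.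
Lemma pair_comp T U (f : T ~> X) (g : T ~> Y) (h : U ~> T) :
  bpair B f g ∘ h = bpair B (f ∘ h) (g ∘ h).
Proof. by rewrite /bpair !simpm. Qed.
Lemma bip_epi T (s t : B ~> T) :
  s ∘ bip_inl B = t ∘ bip_inl B -> s ∘ bip_inr B = t ∘ bip_inr B -> s = t.
Proof.
move=> e1 e2; rewrite -[s]compm1 -[t]compm1 -(bip_sum B) !compDr -!compmA.
by rewrite e1 e2.
Qed.
Lemma bip_mono T (s t : T ~> B) :
  bip_fst B ∘ s = bip_fst B ∘ t -> bip_snd B ∘ s = bip_snd B ∘ t -> s = t.
Proof.
move=> e1 e2; rewrite -[s]comp1m -[t]comp1m -(bip_sum B) !compDl !compmA.
by rewrite e1 e2.
Qed.
Lemma pair_inj T (f f' : T ~> X) (g g' : T ~> Y) :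
  bpair B f g = bpair B f' g' -> f = f' /\ g = g'.
Proof.
by move=> e; rewrite -(fst_pair f g) -{2}(snd_pair f g) e fst_pair snd_pair.
Qed.
End Bip.

End PreAddTheory.

Definition op_pre (C : preaddcat) : preaddcat.
refine (@PreAddCat C (fun X Y => hom Y X) (fun X => idm X)
  (fun X Y Z g f => f ∘ g) _ _ _ _ _).
- by move=> *; rewrite compmA.
- by move=> *; rewrite compm1.
- by move=> *; rewrite comp1m.
- by move=> *; rewrite compDr.
- by move=> *; rewrite compDl.
Defined.

Lemma op_iso (C : preaddcat) (X Y : C) (f : X ~> Y) :
  is_iso f -> @is_iso (op_pre C) Y X f.
Proof. by move=> [g [? ?]]; exists g. Qed.

Lemma iso_op (C : preaddcat) (X Y : C) (f : X ~> Y) :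
  @is_iso (op_pre C) Y X f -> is_iso f.
Proof. by move=> [g [? ?]]; exists g. Qed.

Definition op_biproduct (C : preaddcat) (X Y : C) (B : biproduct X Y) :
  @biproduct (op_pre C) X Y.
refine (@Biproduct (op_pre C) X Y B (bip_fst B) (bip_snd B) (bip_inl B)
   (bip_inr B) _ _ _ _ _).
- exact: (bip_fst_inl B).
- exact: (bip_snd_inr B).
- exact: (bip_snd_inl B).
- exact: (bip_fst_inr B).
- exact: (bip_sum B).
Defined.

Definition op_add (C : addcat) : addcat.
refine (@AddCat (op_pre C) _ _).
- exact: (@zero_ex C).
- by move=> X Y; case: (biproduct_ex (X : C) Y) => B; exists; exact: op_biproduct.
Defined.

Definition op_exact (E : exactcat) : exactcat.
refine (@ExactCat (op_add E) (fun X Y Z i p => @conflation E Z Y X p i)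
  _ _ _ _ _ _ _ _ _).
- by move=> X Y Z i p /conf_cokernel.
- by move=> X Y Z i p /conf_kernel.
- move=> X Y Z X' Y' Z' i p i' p' a b c k /iso_op [a' [a1 a2]] /iso_op[b' [b1 b2]]
    /iso_op [c' [c1 c2]] e1 e2.
  apply: (@conf_isom E _ _ _ _ _ _ p i p' i' c' b' a' k).
  + by exists c.
  + by exists b.
  + by exists a.
  + rewrite /= in e1 e2 *; rewrite -[LHS]compm1 -c2 -!compmA; congr (_ ∘ _).
    by rewrite (compmA b') e2 -compmA b1 comp1m.
  + rewrite /= in e1 e2 *; rewrite -[LHS]compm1 -b2 -!compmA; congr (_ ∘ _).
    by rewrite (compmA a') e1 -compmA a1 comp1m.
- by move=> X; apply: (@deflation_id E).
- by move=> X; apply: (@inflation_id E).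
- by move=> X Y Z j i di dj; apply: (@deflation_comp E).
- by move=> X Y Z j i di dj; apply: (@inflation_comp E).
- move=> X Y X' i f /(@deflation_pullback E) h; have [P [g [q [[e u] d]]]] := h _ f.
  by exists P, g, q; do !split.
- move=> X Y X' i f /(@inflation_pushout E) h; have [P [g [q [[e u] d]]]] := h _ f.
  by exists P, g, q; do !split.
Defined.

Section ExactTheory.
Variable E : exactcat.
Implicit Types X Y Z T : E.

Lemma conf_zero X Y Z (i : X ~> Y) (p : Y ~> Z) : conflation i p -> p ∘ i = 0.
Proof. by move/conf_kernel => []. Qed.

Lemma kernel_conf X Y Z (i : X ~> Y) (p : Y ~> Z) :
  is_kernel i p -> deflation p -> conflation i p.
Proof.
move=> k [X' [i' c]]; have [a [ia ea]] := kernel_uniq (conf_kernel c) k.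
apply: (conf_isom c ia (is_iso_id Y) (is_iso_id Z)); by rewrite !simpm.
Qed.

Lemma inflation_iso X Y X' Y' (i : X ~> Y) (i' : X' ~> Y') (a : X ~> X') (b : Y ~> Y') :
  is_iso a -> is_iso b -> b ∘ i = i' ∘ a -> inflation i -> inflation i'.
Proof.
move=> ia ib e [Z [p c]]; case: (ib) => b' [b1 b2].
exists Z, (p ∘ b'); apply: (conf_isom c ia ib (is_iso_id Z)) => //.
by rewrite comp1m compmA b1 compm1.
Qed.

Lemma zero_conf_r X Y : is_zero X -> conflation (0 : X ~> Y) (idm Y).
Proof.
move=> zX; apply: kernel_conf; last exact: deflation_id.
split=> [|T f]; first by rewrite comp0r.
rewrite comp1m => ->; exists 0; split=> [|g _]; first by rewrite comp0r.
by rewrite [g](zero_to _ zX).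
Qed.

End ExactTheory.

Section ExactTheory2.
Variable E : exactcat.
Implicit Types X Y Z T : E.

Lemma coker_conf X Y Z (i : X ~> Y) (p : Y ~> Z) :
  is_cokernel p i -> inflation i -> conflation i p.
Proof. exact: (@kernel_conf (op_exact E) Z Y X p i). Qed.

Lemma zero_conf_l X Y : is_zero X -> conflation (idm Y) (0 : Y ~> X).
Proof. exact: (@zero_conf_r (op_exact E) X Y). Qed.

Lemma deflation_iso X Y X' Y' (i : X ~> Y) (i' : X' ~> Y') (a : X ~> X') (b : Y ~> Y') :
  is_iso a -> is_iso b -> b ∘ i = i' ∘ a -> deflation i -> deflation i'.
Proof.
move=> ia ib e [Z [p c]]; case: (ia) => a' [a1 a2].
exists Z, (a ∘ p); apply: (conf_isom c (is_iso_id Z) ia ib) => //.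
by rewrite compm1.
Qed.

Lemma iso_inflation X Y (f : X ~> Y) : is_iso f -> inflation f.
Proof.
move=> h; apply: (inflation_iso (is_iso_id X) h) (inflation_id X).
by [].
Qed.

Lemma iso_deflation X Y (f : X ~> Y) : is_iso f -> deflation f.
Proof.
move=> h; apply: (deflation_iso (is_iso_id X) h) (deflation_id X).
by [].
Qed.

Lemma pushout_inflation X Y X' P (i : X ~> Y) (f : X ~> X') (g : Y ~> P)
   (j : X' ~> P) : is_pushout i f g j -> inflation i -> inflation j.
Proof.
move=> k ii; have [P' [g' [j' [k' ij]]]] := inflation_pushout f ii.
have [a [ia e1 e2]] := pushout_uniq k' k.
by apply: (inflation_iso (is_iso_id X') ia _ ij); rewrite compm1.
Qed.

Lemma pushout_conf X Y Z X' P (i : X ~> Y) (p : Y ~> Z) (f : X ~> X')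
  (g : Y ~> P) (j : X' ~> P) :
  is_pushout i f g j -> conflation i p ->
  exists q : P ~> Z, conflation j q /\ q ∘ g = p.
Proof.
move=> k c.
have [|q [e1 e2]] := pushout_desc (y := p) (x := 0 : X' ~> Z) k.
  by rewrite comp0l (conf_zero c).
exists q; split=> //; apply: coker_conf; last first.
  by apply: (pushout_inflation k); exists Z, p.
split=> // T h hj.
have [|r er] := coker_desc (f := h ∘ g) (conf_cokernel c).
  by rewrite compmA k.1 -compmA hj comp0l.
exists r; split.
  apply: (pushout_epi k); rewrite compmA ?e1 ?er //.
  by rewrite e2 hj comp0r.
move=> r' er'; apply: (coker_epi (conf_cokernel c)).
by rewrite er -er' compmA e1.
Qed.

End ExactTheory2.

Section ExactTheory3.
Variable E : exactcat.
Implicit Types X Y Z T : E.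

Lemma pullback_conf X Y Z Z' P (i : X ~> Y) (p : Y ~> Z) (f : Z' ~> Z)
  (g : P ~> Y) (q : P ~> Z') :
  is_pullback p f g q -> conflation i p ->
  exists j : X ~> P, conflation j q /\ g ∘ j = i.
Proof.
move=> [e u] c.
apply: (@pushout_conf (op_exact E) Z Y X Z' P p i f g q _ c).
by split.
Qed.

Lemma noether (X Y Z A B C : E) (i : X ~> Y) (j : Y ~> Z) (p : Y ~> A) (q : Z ~> C)
   (r : Z ~> B) (s : A ~> B) :
  conflation i p -> conflation j q -> conflation (j ∘ i) r -> s ∘ p = r ∘ j ->
  exists t : B ~> C, conflation s t /\ t ∘ r = q.
Proof.
move=> c1 c2 c3 e; apply: (pushout_conf (f := p) _ c2); split=> [|T y x h]; first by rewrite e.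
have [|t et] := coker_desc (f := y) (conf_cokernel c3).
  by rewrite -compmA h compmA (conf_zero c1) comp0r.
exists t; split.
  split=> //; apply: (coker_epi (conf_cokernel c1)).
  by rewrite compmA e -compmA et h.
move=> t' [h1 h2]; apply: (coker_epi (conf_cokernel c3)); by rewrite et h1.
Qed.

Lemma five_inflation_aux (D B' C C' X' : E) (d : D ~> B') (i1 : X' ~> D) (i' : X' ~> B')
    (p1 : D ~> C) (p' : B' ~> C') (c : C ~> C') :
  conflation i1 p1 -> conflation i' p' -> d ∘ i1 = i' -> p' ∘ d = c ∘ p1 ->
  inflation c -> inflation d.
Proof.
move=> k1 k' e1 e2 [Q [q kc]].
exists Q, (q ∘ p'); apply: kernel_conf; last first.
  by apply: deflation_comp; [exists X', i' | exists C, c].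
have dmono T (x : T ~> D) : d ∘ x = 0 -> x = 0.
  move=> h; have : p1 ∘ x = 0.
    apply: (kernel_mono0 (conf_kernel kc)).
    by rewrite -compmA -e2 compmA h comp0r.
  move=> /(kernel_lift (conf_kernel k1)) [y ey].
  rewrite -ey [y](kernel_mono0 (conf_kernel k')) ?comp0r //.
  by rewrite -e1 compmA ey.
split=> [|T f h]; first by rewrite compmA e2 -compmA (conf_zero kc) comp0l.
have [|g eg] := kernel_lift (f := p' ∘ f) (conf_kernel kc).
  by rewrite -compmA.
have dp : deflation p1 by exists X', i1.
have [T' [g' [t [pb [N [n kt]]]]]] := deflation_pullback g dp.
have [|h' eh] := kernel_lift (f := d ∘ g' - f ∘ t) (conf_kernel k').
  rewrite compBr -compmA e2 compmA pb.1 -compmA eg compmA.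
  exact: subrr.
have ed : d ∘ (g' - i1 ∘ h') = f ∘ t.
  by rewrite compBr -[d ∘ (i1 ∘ h')]compmA e1 eh opprB addrC subrK.
have [|r er] := coker_desc (f := g' - i1 ∘ h') (conf_cokernel kt).
  apply: dmono; rewrite -compmA ed compmA (conf_zero kt).
  exact: comp0r.
exists r; split.
  apply: (coker_epi (conf_cokernel kt)); by rewrite compmA er.
move=> r' er'; apply/eqP; rewrite -subr_eq0; apply/eqP/dmono.
rewrite compBr er'; apply: (coker_epi0 (conf_cokernel kt)).
by rewrite compBl compmA er ed subrr.
Qed.

Lemma five_inflation (A B C A' B' C' : E) (i : A ~> B) (p : B ~> C) (i' : A' ~> B')
    (p' : B' ~> C') (a : A ~> A') (b : B ~> B') (c : C ~> C') :
  conflation i p -> conflation i' p' -> b ∘ i = i' ∘ a -> p' ∘ b = c ∘ p ->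
  inflation a -> inflation c -> inflation b.
Proof.
move=> k k' e1 e2 ia ic.
have ii : inflation i by exists C, p.
have [D [b1 [i1 [po inf1]]]] := inflation_pushout a ii.
have [p1 [k1 ep1]] := pushout_conf po k.
have infb1 : inflation b1 by apply: (pushout_inflation (pushout_sym po)).
have [b2 [eb1 eb2]] := pushout_desc po e1.
rewrite -eb1; apply: inflation_comp => //.
apply: (five_inflation_aux (c := c) k1 k') => //.
apply: (pushout_epi po); rewrite !compmA.
  by rewrite eb1 ep1 e2.
by rewrite eb2 (conf_zero k1) (conf_zero k') comp0r.
Qed.

End ExactTheory3.

Section ExactTheory4.
Variable E : exactcat.
Implicit Types X Y Z T : E.

Lemma bip_conf X Y (B : biproduct X Y) : conflation (bip_inl B) (bip_snd B).
Proof.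
have [O zO] := zero_ex E.
apply: coker_conf.
  split=> [|T f h]; first exact: bip_snd_inl.
  exists (f ∘ bip_inr B); split.
    apply: bip_epi; rewrite !compmA ?bip_snd_inl ?bip_snd_inr ?simpm //.
  by move=> g <-; rewrite compmA bip_snd_inr compm1.
apply: (@pushout_inflation E O Y X B 0 0 (bip_inr B)); last first.
  by exists Y, (idm Y); apply: zero_conf_r.
split=> [|T y x _]; first by rewrite !comp0r.
exists (bcopair B x y); split; first by rewrite copair_inr copair_inl.
by move=> t [<- <-]; apply: bip_epi; rewrite ?copair_inl ?copair_inr.
Qed.

Lemma bip_conf' X Y (B : biproduct X Y) : conflation (bip_inr B) (bip_fst B).
Proof.
exact: (bip_conf (Biproduct (bip_snd_inr B) (bip_fst_inl B) (bip_snd_inl B)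
  (bip_fst_inr B) (etrans (addrC _ _) (bip_sum B)))).
Qed.

Lemma shear_iso X Y (B : biproduct X Y) (f : X ~> Y) :
  is_iso (bpair B (bip_fst B) (f ∘ bip_fst B + bip_snd B)).
Proof.
exists (bpair B (bip_fst B) (bip_snd B - f ∘ bip_fst B)); split;
 apply: bip_mono; rewrite -compmA ?fst_pair ?snd_pair ?compm1 ?fst_pair //.
  by rewrite compBl compmA fst_pair snd_pair addrC addKr.
by rewrite compDl compmA fst_pair snd_pair addrC subrK.
Qed.

Lemma bip_map_inflation X Y X' Y' (B : biproduct X Y) (B' : biproduct X' Y')
    (f : X ~> X') (g : Y ~> Y') : inflation f -> inflation g ->
  inflation (bpair B' (f ∘ bip_fst B) (g ∘ bip_snd B)).
Proof.
move=> inf ing; apply: (five_inflation (bip_conf B) (bip_conf B') _ _ inf ing).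
  apply: bip_mono; rewrite -!compmA ?fst_pair ?snd_pair !compmA.
    by rewrite bip_fst_inl -compmA bip_fst_inl compm1 comp1m.
  by rewrite bip_snd_inl -compmA bip_snd_inl comp0l comp0r.
by rewrite snd_pair.
Qed.

Lemma pair_inflation X Y J (B : biproduct Y J) (f : X ~> Y) (i : X ~> J) :
  inflation i -> inflation (bpair B f i).
Proof.
move=> ii; have [D] := biproduct_ex X Y; have [D'] := biproduct_ex J Y.
have h1 : inflation (bpair D (idm X) f).
  apply: (inflation_iso (is_iso_id X) (shear_iso D f)) (_ : inflation (bip_inl D)).
    rewrite compm1; apply: bip_mono; rewrite -compmA ?fst_pair ?snd_pair //.
      exact: bip_fst_inl.
    by rewrite compDl compmA bip_fst_inl bip_snd_inl addr0 compm1.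
  by exists Y, (bip_snd D); apply: bip_conf.
have h2 := bip_map_inflation D D' ii (inflation_id Y).
have h3 := inflation_comp h1 h2.
have sw : is_iso (bpair B (bip_snd D') (bip_fst D')).
  exists (bpair D' (bip_snd B) (bip_fst B)); split;
  apply: bip_mono; by rewrite -compmA ?fst_pair ?snd_pair compm1 ?fst_pair ?snd_pair.
apply: (inflation_iso (is_iso_id X) sw _ h3).
rewrite compm1; apply: bip_mono; rewrite -!compmA ?fst_pair ?snd_pair.
  by rewrite compmA snd_pair comp1m.
by rewrite fst_pair compmA fst_pair compm1.
Qed.

End ExactTheory4.

Section ExactTheory5.
Variable E : exactcat.
Implicit Types X Y Z T : E.

Lemma copair_deflation X Y J (B : biproduct Y J) (f : Y ~> X) (p : J ~> X) :
  deflation p -> deflation (bcopair B f p).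
Proof. exact: (@pair_inflation (op_exact E) X Y J (op_biproduct B) f p). Qed.

End ExactTheory5.

Section Projective.
Variable E : exactcat.

Definition projective (P : E) :=
  forall (Y Z : E) (p : Y ~> Z) (f : P ~> Z), deflation p ->
    exists g : P ~> Y, p ∘ g = f.

Definition injective_obj (I : E) :=
  forall (X Y : E) (i : X ~> Y) (f : X ~> I), inflation i ->
    exists g : Y ~> I, g ∘ i = f.

End Projective.

Record frobcat := FrobCat {
  frob_exact :> exactcat;
  enough_projectives : forall X : frob_exact,
    exists (P : frob_exact) (p : P ~> X), projective P /\ deflation p;
  enough_injectives : forall X : frob_exact,
    exists (I : frob_exact) (i : X ~> I), injective_obj I /\ inflation i;
  projective_injective : forall X : frob_exact,
    projective X <-> injective_obj X }.

(* A chain X^0 -> ... -> X^l of admissible monomorphisms: for h : k <= l,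
   [chain_ob X h] is X^k; for h : k < l, [chain_map X h] is alpha^k. *)
Record mchain (E : exactcat) (l : nat) := MChain {
  chain_ob :> forall k : nat, (k <= l)%N -> E;
  chain_map : forall (k : nat) (h : (k < l)%N),
    chain_ob (ltnW h) ~> chain_ob h;
  chain_infl : forall (k : nat) (h : (k < l)%N), inflation (chain_map h) }.

Record ladder (E : exactcat) (l : nat) (X Y : mchain E l) := Ladder {
  ladder_map :> forall (k : nat) (h : (k <= l)%N), X k h ~> Y k h;
  ladder_comm : forall (k : nat) (h : (k < l)%N),
    chain_map Y h ∘ ladder_map (ltnW h) = ladder_map h ∘ chain_map X h }.

Section LadderZmod.
Variables (E : exactcat) (l : nat) (X Y : mchain E l).
Implicit Types f g : ladder X Y.

Lemma ladder_ext f g : (forall k (h : (k <= l)%N), f k h = g k h) -> f = g.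
Proof.
case: f g => [f cf] [g cg] /= e.
have {}e : f = g by apply: functional_extensionality_dep => k;
  apply: functional_extensionality_dep => h.
by case: _ / e cg => cg; rewrite (Prop_irrelevance cf cg).
Qed.

HB.instance Definition _ := gen_eqMixin (ladder X Y).
HB.instance Definition _ := gen_choiceMixin (ladder X Y).

Lemma ladder_zero_comm k (h : (k < l)%N) :
  chain_map Y h ∘ (0 : X k (ltnW h) ~> Y k (ltnW h)) = 0 ∘ chain_map X h.
Proof. by rewrite comp0l comp0r. Qed.
Definition ladder_zero : ladder X Y :=
  @Ladder E l X Y (fun _ _ => 0) ladder_zero_comm.

Lemma ladder_opp_comm f k (h : (k < l)%N) :
  chain_map Y h ∘ (- f k (ltnW h)) = (- f _ h) ∘ chain_map X h.
Proof. by rewrite compNl compNr ladder_comm. Qed.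
Definition ladder_opp f : ladder X Y :=
  @Ladder E l X Y (fun k h => - f k h) (ladder_opp_comm f).

Lemma ladder_add_comm f g k (h : (k < l)%N) :
  chain_map Y h ∘ (f k (ltnW h) + g k (ltnW h)) = (f _ h + g _ h) ∘ chain_map X h.
Proof. by rewrite compDl compDr !ladder_comm. Qed.
Definition ladder_add f g : ladder X Y :=
  @Ladder E l X Y (fun k h => f k h + g k h) (ladder_add_comm f g).

Lemma ladder_addA : associative ladder_add.
Proof. by move=> f g h; apply: ladder_ext => k h' /=; rewrite addrA. Qed.
Lemma ladder_addC : commutative ladder_add.
Proof. by move=> f g; apply: ladder_ext => k h' /=; rewrite addrC. Qed.
Lemma ladder_add0 : left_id ladder_zero ladder_add.
Proof. by move=> f; apply: ladder_ext => k h' /=; rewrite add0r. Qed.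
Lemma ladder_addN : left_inverse ladder_zero ladder_opp ladder_add.
Proof. by move=> f; apply: ladder_ext => k h' /=; rewrite addNr. Qed.

HB.instance Definition _ := GRing.isZmodule.Build (ladder X Y)
  ladder_addA ladder_addC ladder_add0 ladder_addN.

End LadderZmod.

Section MorPre.
Variables (E : exactcat) (l : nat).
Implicit Types X Y Z : mchain E l.

Lemma ladder_id_comm X k (h : (k < l)%N) :
  chain_map X h ∘ idm (X k (ltnW h)) = idm _ ∘ chain_map X h.
Proof. by rewrite compm1 comp1m. Qed.
Definition ladder_id X : ladder X X :=
  @Ladder E l X X (fun k h => idm (X k h)) (@ladder_id_comm X).

Lemma ladder_comp_comm X Y Z (g : ladder Y Z) (f : ladder X Y) k (h : (k < l)%N) :
  chain_map Z h ∘ (g k (ltnW h) ∘ f k (ltnW h)) = (g _ h ∘ f _ h) ∘ chain_map X h.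
Proof. by rewrite -compmA ladder_comm !compmA ladder_comm. Qed.
Definition ladder_comp X Y Z (g : ladder Y Z) (f : ladder X Y) : ladder X Z :=
  @Ladder E l X Z (fun k h => g k h ∘ f k h) (ladder_comp_comm g f).

Definition mor_pre : preaddcat.
refine (@PreAddCat (mchain E l) (fun X Y => ladder X Y : zmodType) ladder_id
  ladder_comp _ _ _ _ _).
- by move=> *; apply: ladder_ext => k h /=; rewrite compmA.
- by move=> *; apply: ladder_ext => k h /=; rewrite comp1m.
- by move=> *; apply: ladder_ext => k h /=; rewrite compm1.
- by move=> *; apply: ladder_ext => k h /=; rewrite compDl.
- by move=> *; apply: ladder_ext => k h /=; rewrite compDr.
Defined.

Lemma chain_choice (S : forall k, (k <= l)%N -> Type)
    (R : forall k (h : (k < l)%N), S k (ltnW h) -> S k.+1 h -> Prop) :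
  (forall h : (0 <= l)%N, inhabited (S 0%N h)) ->
  (forall k (h : (k < l)%N) (s : S k (ltnW h)), exists s', R k h s s') ->
  exists s : forall k h, S k h, forall k (h : (k < l)%N), R k h (s k (ltnW h)) (s _ h).
Proof.
move=> s0 ss.
have g0 (h : (0 <= l)%N) : S 0%N h.
  by apply: (projT1 (cid (_ : exists x : S 0%N h, True))); case: (s0 h) => x; exists x.
exists (fix F k : forall h : (k <= l)%N, S k h :=
  match k with
  | 0 => g0
  | k'.+1 => fun h => projT1 (cid (ss k' h (F k' (ltnW h))))
  end).
by move=> k h; exact: (projT2 (cid (ss k h _))).
Qed.

Lemma term_choice (S : forall k, (k <= l)%N -> Type) :
  (forall k h, inhabited (S k h)) -> inhabited (forall k h, S k h).
Proof.
move=> H; exists => k h.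
by apply: (projT1 (cid (_ : exists x : S k h, True))); case: (H k h) => x; exists x.
Qed.

Lemma term_ex (S : forall k, (k <= l)%N -> Type) (P : forall k h, S k h -> Prop) :
  (forall k h, exists x, P k h x) -> exists x, forall k h, P k h (x k h).
Proof.
move=> H; exists (fun k h => projT1 (cid (H k h))) => k h; exact: (projT2 (cid _)).
Qed.

Lemma map_ex (S : forall k, (k < l)%N -> Type) (P : forall k h, S k h -> Prop) :
  (forall k h, exists x, P k h x) -> exists x, forall k h, P k h (x k h).
Proof.
move=> H; exists (fun k h => projT1 (cid (H k h))) => k h; exact: (projT2 (cid _)).
Qed.

End MorPre.

Lemma noether_op (E : exactcat) (K X Y L Z M : E) (i : K ~> X) (p : X ~> Y)
    (j : L ~> Y) (q : Y ~> Z) (m : M ~> X) (s : M ~> L) :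
  conflation i p -> conflation j q -> conflation m (q ∘ p) -> j ∘ s = p ∘ m ->
  exists t : K ~> M, conflation t s /\ m ∘ t = i.
Proof.
move=> c1 c2 c3 e.
exact: (@noether (op_exact E) Z Y X L M K q p j i m s c2 c1 c3 e).
Qed.

Section Mor.
Variables (E : exactcat) (l : nat).
Implicit Types X Y Z T : mchain E l.

Local Notation M := (mor_pre E l).

Lemma ladder_eq X Y (f g : ladder X Y) k (h : (k <= l)%N) : f = g -> f k h = g k h.
Proof. by move=> ->. Qed.

Lemma mor_kernel X Y Z (i : ladder X Y) (p : ladder Y Z) :
  (forall k (h : (k <= l)%N), is_kernel (i k h) (p k h)) -> @is_kernel M X Y Z i p.
Proof.
move=> K; split; first by apply: ladder_ext => k h; exact: (K k h).1.
move=> T f pf.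
have [|g eg] := @term_ex l _ (fun k h (g : (T : mchain E l) k h ~> X k h) => i k h ∘ g = f k h).
  by move=> k h; apply: (kernel_lift (K k h)); exact: (ladder_eq h pf).
have gc k (h : (k < l)%N) : chain_map X h ∘ g k (ltnW h) = g _ h ∘ chain_map T h.
  apply: (kernel_mono (K _ h)); rewrite -!compmA -ladder_comm compmA !eg.
  exact: ladder_comm.
exists (Ladder gc); split; first by apply: ladder_ext => k h; exact: eg.
move=> g' eg'; apply: ladder_ext => k h /=; apply: (kernel_mono (K _ h)).
by rewrite eg -eg'.
Qed.

Lemma mor_cokernel X Y Z (i : ladder X Y) (p : ladder Y Z) :
  (forall k (h : (k <= l)%N), is_cokernel (p k h) (i k h)) ->
  @is_cokernel M X Y Z p i.
Proof.
move=> K; split; first by apply: ladder_ext => k h; exact: (K k h).1.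
move=> T f pf.
have [|g eg] := @term_ex l _ (fun k h (g : Z k h ~> (T : mchain E l) k h) => g ∘ p k h = f k h).
  by move=> k h; apply: (coker_desc (K k h)); exact: (ladder_eq h pf).
have gc k (h : (k < l)%N) : chain_map T h ∘ g k (ltnW h) = g _ h ∘ chain_map Z h.
  apply: (coker_epi (K _ (ltnW h))); rewrite !compmA ladder_comm eg -[RHS]compmA eg.
  exact: ladder_comm.
exists (Ladder gc); split; first by apply: ladder_ext => k h; exact: eg.
move=> g' eg'; apply: ladder_ext => k h /=; apply: (coker_epi (K _ h)).
by rewrite eg -eg'.
Qed.

Lemma mor_pushout X Y X' P (i : ladder X Y) (f : ladder X X') (g : ladder Y P)
    (j : ladder X' P) :
  (forall k (h : (k <= l)%N), is_pushout (i k h) (f k h) (g k h) (j k h)) ->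
  @is_pushout M X Y X' P i f g j.
Proof.
move=> K; split; first by apply: ladder_ext => k h; exact: (K k h).1.
move=> T y x e.
have [|t et] := @term_ex l _ (fun k h (t : P k h ~> (T : mchain E l) k h) =>
   t ∘ g k h = y k h /\ t ∘ j k h = x k h).
  by move=> k h; apply: (pushout_desc (K k h)); exact: (ladder_eq h e).
have tc k (h : (k < l)%N) : chain_map T h ∘ t k (ltnW h) = t _ h ∘ chain_map P h.
  have [a b] := et k (ltnW h); have [c d] := et _ h.
  apply: (pushout_epi (K _ (ltnW h))); rewrite !compmA !ladder_comm -!compmA.
    by rewrite compmA a c ladder_comm.
  by rewrite compmA b d ladder_comm.
exists (Ladder tc); split.
  by split; apply: ladder_ext => k h; have [] := et k h.
move=> t' [e1 e2]; apply: ladder_ext => k h /=; have [a b] := et k h.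
by apply: (pushout_epi (K _ h)); rewrite ?a ?b -?e1 -?e2.
Qed.

Lemma mor_pullback Y Z Z' P (p : ladder Y Z) (f : ladder Z' Z) (g : ladder P Y)
    (q : ladder P Z') :
  (forall k (h : (k <= l)%N), is_pullback (p k h) (f k h) (g k h) (q k h)) ->
  @is_pullback M Y Z Z' P p f g q.
Proof.
move=> K; split; first by apply: ladder_ext => k h; exact: (K k h).1.
move=> T y x e.
have [|t et] := @term_ex l _ (fun k h (t : (T : mchain E l) k h ~> P k h) =>
   g k h ∘ t = y k h /\ q k h ∘ t = x k h).
  by move=> k h; apply: (pullback_lift (K k h)); exact: (ladder_eq h e).
have tc k (h : (k < l)%N) : chain_map P h ∘ t k (ltnW h) = t _ h ∘ chain_map T h.
  have [a b] := et k (ltnW h); have [c d] := et _ h.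
  apply: (pullback_mono (K _ h)); rewrite -!compmA -!ladder_comm !compmA.
    by rewrite a -[RHS]compmA c ladder_comm.
  by rewrite b -[RHS]compmA d ladder_comm.
exists (Ladder tc); split.
  by split; apply: ladder_ext => k h; have [] := et k h.
move=> t' [e1 e2]; apply: ladder_ext => k h /=; have [a b] := et k h.
by apply: (pullback_mono (K _ h)); rewrite ?a ?b -?e1 -?e2.
Qed.

Lemma mor_iso_term X Y (f : ladder X Y) : @is_iso M X Y f ->
  forall k (h : (k <= l)%N), is_iso (f k h).
Proof.
by move=> [g [a b]] k h; exists ((g : ladder Y X) k h); split;
   [exact: (ladder_eq h a) | exact: (ladder_eq h b)].
Qed.

Lemma mor_zero_ex : exists Z : M, is_zero Z.
Proof.
have [O zO] := zero_ex E.
pose Z := @MChain E l (fun _ _ => O) (fun _ _ => idm O) (fun _ _ => inflation_id O).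
by exists (Z : M); apply: ladder_ext => k h.
Qed.

Lemma mor_biproduct_ex (X Y : M) : inhabited (biproduct X Y).
Proof.
move: X Y => X Y.
have [B] := term_choice (fun k h => biproduct_ex (X k h) (Y k h)).
pose m k (h : (k < l)%N) : B k (ltnW h) ~> B _ h :=
  bpair (B _ h) (chain_map X h ∘ bip_fst _) (chain_map Y h ∘ bip_snd _).
have im k (h : (k < l)%N) : inflation (m k h).
  by apply: bip_map_inflation; exact: chain_infl.
pose S := @MChain E l (fun k h => B k h) m im.
have c1 k (h : (k < l)%N) : chain_map S h ∘ bip_inl (B k (ltnW h)) =
    bip_inl (B _ h) ∘ chain_map X h.
  rewrite /= /m; apply: bip_mono; rewrite -!compmA ?fst_pair ?snd_pair !compmA.
    by rewrite bip_fst_inl -compmA bip_fst_inl compm1 comp1m.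
  by rewrite bip_snd_inl -compmA bip_snd_inl comp0l comp0r.
have c2 k (h : (k < l)%N) : chain_map S h ∘ bip_inr (B k (ltnW h)) =
    bip_inr (B _ h) ∘ chain_map Y h.
  rewrite /= /m; apply: bip_mono; rewrite -!compmA ?fst_pair ?snd_pair !compmA.
    by rewrite bip_fst_inr -compmA bip_fst_inr comp0l comp0r.
  by rewrite bip_snd_inr -compmA bip_snd_inr compm1 comp1m.
have c3 k (h : (k < l)%N) : chain_map X h ∘ bip_fst (B k (ltnW h)) =
    bip_fst (B _ h) ∘ chain_map S h by rewrite /= /m fst_pair.
have c4 k (h : (k < l)%N) : chain_map Y h ∘ bip_snd (B k (ltnW h)) =
    bip_snd (B _ h) ∘ chain_map S h by rewrite /= /m snd_pair.
exists; refine (@Biproduct M X Y S (@Ladder E l X S (fun k h => bip_inl (B k h)) c1)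
  (@Ladder E l Y S (fun k h => bip_inr (B k h)) c2)
  (@Ladder E l S X (fun k h => bip_fst (B k h)) c3)
  (@Ladder E l S Y (fun k h => bip_snd (B k h)) c4) _ _ _ _ _);
apply: ladder_ext => k h.
- exact: bip_fst_inl.
- exact: bip_snd_inr.
- exact: bip_fst_inr.
- exact: bip_snd_inl.
- exact: bip_sum.
Qed.

Definition mor_add : addcat := AddCat mor_zero_ex mor_biproduct_ex.

Definition mor_conflation X Y Z (i : ladder X Y) (p : ladder Y Z) :=
  forall k (h : (k <= l)%N), conflation (i k h) (p k h).

Lemma mor_inflation_comp X Y W Z V (i : ladder X Y) (p : ladder Y Z)
    (j : ladder Y W) (q : ladder W V) :
  mor_conflation i p -> mor_conflation j q ->
  exists C (r : ladder W C), mor_conflation (ladder_comp j i) r.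
Proof.
move=> c1 c2.
have [|C eC] := @term_ex l _ (fun k h (C : E) =>
  exists r : W k h ~> C, conflation (j k h ∘ i k h) r).
  move=> k h; apply: inflation_comp; first by exists (Z k h), (p k h).
  by exists (V k h), (q k h).
have [r er] := term_ex eC.
have [|m em] := @map_ex l _ (fun k h (m : C k (ltnW h) ~> C _ h) =>
   m ∘ r k (ltnW h) = r _ h ∘ chain_map W h).
  move=> k h; apply: (coker_desc (conf_cokernel (er _ (ltnW h)))).
  by rewrite compmA (ladder_comm (ladder_comp j i) h) -compmA /=
    (conf_zero (er _ h)) comp0l.
have im k (h : (k < l)%N) : inflation (m k h).
  have H k' (h' : (k' <= l)%N) : exists s : Z k' h' ~> C k' h',
      s ∘ p k' h' = r k' h' ∘ j k' h'.
    apply: (coker_desc (conf_cokernel (c1 _ h'))).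
    by rewrite compmA (conf_zero (er _ h')).
  have [s1 e1] := H _ (ltnW h); have [s2 e2] := H _ h.
  have [t1 [k1 f1]] := noether (c1 _ _) (c2 _ _) (er _ _) e1.
  have [t2 [k2 f2]] := noether (c1 _ _) (c2 _ _) (er _ _) e2.
  apply: (five_inflation (a := chain_map Z h) (c := chain_map V h) k1 k2).
  - apply: (coker_epi (conf_cokernel (c1 _ (ltnW h)))).
    by rewrite !compmA ladder_comm e1 -!compmA e2 em !compmA ladder_comm.
  - apply: (coker_epi (conf_cokernel (er _ (ltnW h)))).
    by rewrite !compmA em f1 -compmA f2 ladder_comm.
  - exact: chain_infl.
  - exact: chain_infl.
pose S := @MChain E l C m im.
by exists S, (@Ladder E l W S r em).
Qed.

Lemma mor_deflation_comp K X Y L Z (i : ladder K X) (p : ladder X Y)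
    (j : ladder L Y) (q : ladder Y Z) :
  mor_conflation i p -> mor_conflation j q ->
  exists N (n : ladder N X), mor_conflation n (ladder_comp q p).
Proof.
move=> c1 c2.
have [|C eC] := @term_ex l _ (fun k h (C : E) =>
  exists r : C ~> X k h, conflation r (q k h ∘ p k h)).
  move=> k h; apply: deflation_comp; first by exists (K k h), (i k h).
  by exists (L k h), (j k h).
have [r er] := term_ex eC.
have [|m em] := @map_ex l _ (fun k h (m : C k (ltnW h) ~> C _ h) =>
   r _ h ∘ m = chain_map X h ∘ r k (ltnW h)).
  move=> k h; apply: (kernel_lift (conf_kernel (er _ h))).
  by rewrite -compmA -(ladder_comm (ladder_comp q p) h) compmA /=
    (conf_zero (er _ (ltnW h))) comp0r.
have im k (h : (k < l)%N) : inflation (m k h).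
  have H k' (h' : (k' <= l)%N) : exists s : C k' h' ~> L k' h',
      j k' h' ∘ s = p k' h' ∘ r k' h'.
    apply: (kernel_lift (conf_kernel (c2 _ h'))).
    by rewrite -compmA (conf_zero (er _ h')).
  have [s1 e1] := H _ (ltnW h); have [s2 e2] := H _ h.
  have [t1 [k1 f1]] := noether_op (c1 _ _) (c2 _ _) (er _ _) e1.
  have [t2 [k2 f2]] := noether_op (c1 _ _) (c2 _ _) (er _ _) e2.
  apply: (five_inflation (a := chain_map K h) (c := chain_map L h) k1 k2).
  - apply: (kernel_mono (conf_kernel (er _ h))).
    by rewrite -!compmA f2 em !compmA f1 ladder_comm.
  - apply: (kernel_mono (conf_kernel (c2 _ h))).
    by rewrite -!compmA e2 -ladder_comm !compmA e1 em -!compmA ladder_comm.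
  - exact: chain_infl.
  - exact: chain_infl.
pose S := @MChain E l C m im.
have em' k (h : (k < l)%N) : chain_map X h ∘ r k (ltnW h) = r _ h ∘ chain_map S h.
  by rewrite em.
by exists S, (@Ladder E l S X r em').
Qed.

Lemma mor_pushout_ex X Y Z X' (i : ladder X Y) (p : ladder Y Z) (f : ladder X X') :
  mor_conflation i p ->
  exists P (g : ladder Y P) (j : ladder X' P), @is_pushout M X Y X' P i f g j /\
    exists q : ladder P Z, mor_conflation j q.
Proof.
move=> c.
have [|P eP] := @term_ex l _ (fun k h (P : E) => exists (g : Y k h ~> P)
   (j : X' k h ~> P), is_pushout (i k h) (f k h) g j /\ inflation j).
  by move=> k h; apply: inflation_pushout; exists (Z k h), (p k h).
have [g eg] := term_ex eP; have [j ej] := term_ex eg.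
have [|q eq] := @term_ex l _ (fun k h (q : P k h ~> Z k h) =>
    conflation (j k h) q /\ q ∘ g k h = p k h).
  by move=> k h; apply: pushout_conf (c k h); exact: (ej k h).1.
have [|m em] := @map_ex l _ (fun k h (m : P k (ltnW h) ~> P _ h) =>
   m ∘ g k (ltnW h) = g _ h ∘ chain_map Y h /\
   m ∘ j k (ltnW h) = j _ h ∘ chain_map X' h).
  move=> k h; apply: (pushout_desc (ej _ (ltnW h)).1).
  by rewrite !compmA !ladder_comm -!compmA (ej _ h).1.1.
have qc k (h : (k < l)%N) : chain_map Z h ∘ q k (ltnW h) = q _ h ∘ m k h.
  have [a b] := em k h; have [kq1 eq1] := eq _ (ltnW h); have [kq2 eq2] := eq _ h.
  apply: (pushout_epi (ej _ (ltnW h)).1); rewrite !compmA.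
    by rewrite eq1 a -compmA eq2 ladder_comm.
  by rewrite b (conf_zero kq1) -compmA (conf_zero kq2) comp0r comp0l.
have im k (h : (k < l)%N) : inflation (m k h).
  have [a b] := em k h; have [kq1 eq1] := eq _ (ltnW h); have [kq2 eq2] := eq _ h.
  apply: (five_inflation (a := chain_map X' h) (c := chain_map Z h) kq1 kq2) => //;
  exact: chain_infl.
pose S := @MChain E l P m im.
have gc k (h : (k < l)%N) : chain_map S h ∘ g k (ltnW h) = g _ h ∘ chain_map Y h.
  exact: (em k h).1.
have jc k (h : (k < l)%N) : chain_map S h ∘ j k (ltnW h) = j _ h ∘ chain_map X' h.
  exact: (em k h).2.
exists S, (@Ladder E l Y S g gc), (@Ladder E l X' S j jc); split.
  by apply: mor_pushout => k h; exact: (ej k h).1.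
by exists (@Ladder E l S Z q qc) => k h; exact: (eq k h).1.
Qed.

Lemma mor_pullback_ex K Y Z Z' (i : ladder K Y) (p : ladder Y Z) (f : ladder Z' Z) :
  mor_conflation i p ->
  exists P (g : ladder P Y) (q : ladder P Z'), @is_pullback M Y Z Z' P p f g q /\
    exists j : ladder K P, mor_conflation j q.
Proof.
move=> c.
have [|P eP] := @term_ex l _ (fun k h (P : E) => exists (g : P ~> Y k h)
   (q : P ~> Z' k h), is_pullback (p k h) (f k h) g q /\ deflation q).
  by move=> k h; apply: deflation_pullback; exists (K k h), (i k h).
have [g eg] := term_ex eP; have [q ej] := term_ex eg.
have [|j eq] := @term_ex l _ (fun k h (j : K k h ~> P k h) =>
    conflation j (q k h) /\ g k h ∘ j = i k h).
  by move=> k h; apply: pullback_conf (c k h); exact: (ej k h).1.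
have [|m em] := @map_ex l _ (fun k h (m : P k (ltnW h) ~> P _ h) =>
   g _ h ∘ m = chain_map Y h ∘ g k (ltnW h) /\
   q _ h ∘ m = chain_map Z' h ∘ q k (ltnW h)).
  move=> k h; apply: (pullback_lift (ej _ h).1).
  by rewrite -!compmA -!ladder_comm !compmA (ej _ (ltnW h)).1.1.
have jc k (h : (k < l)%N) : m k h ∘ j k (ltnW h) = j _ h ∘ chain_map K h.
  have [a b] := em k h; have [kq1 eq1] := eq _ (ltnW h); have [kq2 eq2] := eq _ h.
  apply: (pullback_mono (ej _ h).1); rewrite -!compmA.
    by rewrite eq2 a compmA eq1 ladder_comm.
  by rewrite b compmA (conf_zero kq1) (conf_zero kq2) comp0r comp0l.
have im k (h : (k < l)%N) : inflation (m k h).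
  have [a b] := em k h; have [kq1 eq1] := eq _ (ltnW h); have [kq2 eq2] := eq _ h.
  apply: (five_inflation (a := chain_map K h) (c := chain_map Z' h) kq1 kq2) => //;
  exact: chain_infl.
pose S := @MChain E l P m im.
have gc k (h : (k < l)%N) : chain_map Y h ∘ g k (ltnW h) = g _ h ∘ chain_map S h.
  by rewrite (em k h).1.
have qc k (h : (k < l)%N) : chain_map Z' h ∘ q k (ltnW h) = q _ h ∘ chain_map S h.
  by rewrite (em k h).2.
exists S, (@Ladder E l S Y g gc), (@Ladder E l S Z' q qc); split.
  by apply: mor_pullback => k h; exact: (ej k h).1.
by exists (@Ladder E l K S j jc) => k h; exact: (eq k h).1.
Qed.

Definition mor_exact : exactcat.
refine (@ExactCat mor_add mor_conflation _ _ _ _ _ _ _ _ _).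
- by move=> X Y Z i p c; apply: mor_kernel => k h; apply: conf_kernel.
- by move=> X Y Z i p c; apply: mor_cokernel => k h; apply: conf_cokernel.
- move=> X Y Z X' Y' Z' i p i' p' a b c k ia ib ic e1 e2 n h.
  apply: (conf_isom (k n h) (mor_iso_term ia h) (mor_iso_term ib h)
    (mor_iso_term ic h)).
    exact: (ladder_eq h e1).
  exact: (ladder_eq h e2).
- move=> X; have [Z zZ] := mor_zero_ex; exists Z, 0 => k h.
  apply: zero_conf_l; exact: (ladder_eq h zZ).
- move=> X; have [Z zZ] := mor_zero_ex; exists Z, 0 => k h.
  apply: zero_conf_r; exact: (ladder_eq h zZ).
- by move=> X Y Z j i [U [p c]] [V [q d]]; exact: mor_inflation_comp c d.
- by move=> X Y Z j i [U [p c]] [V [q d]]; exact: mor_deflation_comp c d.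
- move=> X Y X' i f [Z [p c]]; have [P [g [j [po [q cq]]]]] := mor_pushout_ex f c.
  by exists P, g, j; split=> //; exists Z, q.
- move=> X Y X' i f [Z [p c]]; have [P [g [j [po [q cq]]]]] := mor_pullback_ex f c.
  by exists P, g, j; split=> //; exists Z, q.
Defined.

End Mor.

Section ProjTheory.
Variable E : exactcat.

Lemma injective_retract (X I : E) (i : X ~> I) (r : I ~> X) :
  r ∘ i = idm X -> injective_obj I -> injective_obj X.
Proof.
move=> ri inj A B j f ij; have [g eg] := inj _ _ j (i ∘ f) ij.
by exists (r ∘ g); rewrite compmA eg -compmA ri comp1m.
Qed.

Lemma projective_retract (X P : E) (p : P ~> X) (s : X ~> P) :
  p ∘ s = idm X -> projective P -> projective X.
Proof.
move=> ri inj A B j f ij; have [g eg] := inj _ _ j (f ∘ p) ij.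
by exists (g ∘ s); rewrite -compmA eg compmA ri compm1.
Qed.

Lemma projective_biproduct (P Q : E) (B : biproduct P Q) :
  projective P -> projective Q -> projective B.
Proof.
move=> hP hQ Y Z p f dp; have [g eg] := hP _ _ p (f ∘ bip_inl B) dp.
have [h eh] := hQ _ _ p (f ∘ bip_inr B) dp.
exists (bcopair B g h); apply: bip_epi.
  by rewrite compmA copair_inl.
by rewrite compmA copair_inr.
Qed.

End ProjTheory.

Section MorFrobenius.
Variables (F : frobcat) (l : nat).
Implicit Types X Y Z : mchain F l.

Lemma injective_chain (I : mchain F l) :
  (forall k (h : (k <= l)%N), injective_obj (I k h)) -> @injective_obj (mor_exact F l) I.
Proof.
move=> inj X0 Y0 i0 f0 [Z0 [p0 c0]].
move: X0 Y0 Z0 i0 p0 f0 c0 => /= X Y Z i p f c.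
pose S k (h : (k <= l)%N) := {g : Y k h ~> I k h | g ∘ i k h = f k h}.
have inf k (h : (k <= l)%N) : inflation (i k h) by exists (Z k h), (p k h).
have [|k h [g eg]|s es] := @chain_choice l S (fun k h s s' =>
    chain_map I h ∘ sval s = sval s' ∘ chain_map Y h).
- by move=> h; have [g eg] := inj _ h _ _ _ (f _ h) (inf _ h); exists; exists g.
- have [g' eg'] := inj _ h _ _ _ (f _ h) (inf _ h).
  have [|e ee] := coker_desc (f := chain_map I h ∘ g - g' ∘ chain_map Y h)
      (conf_cokernel (c _ (ltnW h))).
    by rewrite compBl !compmA eg ladder_comm ladder_comm -compmA eg' subrr.
  have [e' ee'] := inj _ h _ _ _ e (chain_infl Z h).
  have E : (g' + e' ∘ p _ h) ∘ i _ h = f _ h.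
    by rewrite compDl compmA (conf_zero (c _ h)) comp0r addr0.
  exists (exist _ (g' + e' ∘ p _ h) E) => /=.
  by rewrite compDl compmA -ladder_comm -compmA ee' ee addrC subrK.
exists (@Ladder F l Y I (fun k h => sval (s k h)) es).
by apply: ladder_ext => k h /=; exact: (svalP (s k h)).
Qed.

Lemma projective_chain (P : mchain F l) :
  (forall k (h : (k <= l)%N), projective (P k h)) -> @projective (mor_exact F l) P.
Proof.
move=> proj X0 Y0 i0 f0 [Z0 [p0 c0]].
move: X0 Y0 Z0 i0 p0 f0 c0 => /= Y Z X p i f c.
pose S k (h : (k <= l)%N) := {g : P k h ~> Y k h | p k h ∘ g = f k h}.
have def k (h : (k <= l)%N) : deflation (p k h) by exists (X k h), (i k h).
have [|k h [g eg]|s es] := @chain_choice l S (fun k h s s' =>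
    chain_map Y h ∘ sval s = sval s' ∘ chain_map P h).
- by move=> h; have [g eg] := proj _ h _ _ _ (f _ h) (def _ h); exists; exists g.
- have [g' eg'] := proj _ h _ _ _ (f _ h) (def _ h).
  have /projective_injective /(_ _ _ _ (idm _) (chain_infl P h)) [r er] := proj _ (ltnW h).
  have E : p _ h ∘ (g' + (chain_map Y h ∘ g - g' ∘ chain_map P h) ∘ r) = f _ h.
    rewrite compDr eg' -compmA compBr -!compmA -ladder_comm eg' -ladder_comm.
    by rewrite compmA eg subrr comp0l addr0.
  exists (exist (fun g => p _ h ∘ g = f _ h) _ E) => /=.
  by rewrite compDl compmA er compm1 addrC subrK.
exists (@Ladder F l P Y (fun k h => sval (s k h)) es).
by apply: ladder_ext => k h /=; exact: (svalP (s k h)).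
Qed.

Record inj_hull (X : F) := InjHull {
  ih_I : F; ih_Q : F; ih_i : X ~> ih_I; ih_p : ih_I ~> ih_Q;
  ih_inj : injective_obj ih_I; ih_conf : conflation ih_i ih_p }.

Record proj_cover (X : F) := ProjCover {
  pc_P : F; pc_K : F; pc_p : pc_P ~> X; pc_k : pc_K ~> pc_P;
  pc_proj : projective pc_P; pc_conf : conflation pc_k pc_p }.

Lemma mor_enough_injectives X : exists (I Z : mchain F l) (i : ladder X I)
    (p : ladder I Z), (forall k (h : (k <= l)%N), injective_obj (I k h)) /\
    mor_conflation i p.
Proof.
have [|k h s|s es] := @chain_choice l (fun k h => inj_hull (X k h)) (fun k h s s' =>
  exists (m : ih_I s ~> ih_I s') (n : ih_Q s ~> ih_Q s'),
  [/\ inflation m, inflation n, m ∘ ih_i s = ih_i s' ∘ chain_map X h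
    & n ∘ ih_p s = ih_p s' ∘ m]).
- move=> h; have [I [i [inj [Z [p c]]]]] := enough_injectives (X 0%N h).
  by exists; exact: InjHull inj c.
- have [P [j [g [po ig]]]] := inflation_pushout (chain_map X h)
    (ex_intro _ _ (ex_intro _ _ (ih_conf s))).
  have [q1 [cg eq1]] := pushout_conf po (ih_conf s).
  have ij := pushout_inflation (pushout_sym po) (chain_infl X h).
  have [I' [e [inj [Q1 [e' ce]]]]] := enough_injectives P.
  have ie : inflation e by exists Q1, e'.
  have [Q' [q' cq]] := inflation_comp ig ie.
  exists (InjHull inj cq) => /=.
  have [|n en] := coker_desc (f := q' ∘ e) (conf_cokernel cg).
    by rewrite compmA (conf_zero cq).
  have [t [cn _]] := noether cg ce cq en.
  exists (e ∘ j), n; split.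
  + exact: inflation_comp.
  + by exists Q1, t.
  + by rewrite !compmA po.1.
  + by rewrite -compmA -en compmA eq1.
have [m em] := map_ex es; have [n en] := map_ex em.
have im k (h : (k < l)%N) : inflation (m k h) by case: (en k h).
have ine k (h : (k < l)%N) : inflation (n k h) by case: (en k h).
pose I := @MChain F l (fun k h => ih_I (s k h)) m im.
pose Z := @MChain F l (fun k h => ih_Q (s k h)) n ine.
have ci k (h : (k < l)%N) : chain_map I h ∘ ih_i (s k (ltnW h)) =
   ih_i (s _ h) ∘ chain_map X h by case: (en k h).
have cp k (h : (k < l)%N) : chain_map Z h ∘ ih_p (s k (ltnW h)) =
   ih_p (s _ h) ∘ chain_map I h by case: (en k h).
exists I, Z, (@Ladder F l X I (fun k h => ih_i (s k h)) ci),
  (@Ladder F l I Z (fun k h => ih_p (s k h)) cp); split=> k h.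
  exact: ih_inj.
exact: ih_conf.
Qed.

Lemma mor_enough_projectives X : exists (P K : mchain F l) (p : ladder P X)
    (i : ladder K P), (forall k (h : (k <= l)%N), projective (P k h)) /\
    mor_conflation i p.
Proof.
have [|k h s|s es] := @chain_choice l (fun k h => proj_cover (X k h)) (fun k h s s' =>
  exists (m : pc_P s ~> pc_P s') (n : pc_K s ~> pc_K s'),
  [/\ inflation m, inflation n, m ∘ pc_k s = pc_k s' ∘ n
    & chain_map X h ∘ pc_p s = pc_p s' ∘ m]).
- move=> h; have [P [p [proj [K [k c]]]]] := enough_projectives (X 0%N h).
  by exists; exact: ProjCover proj c.
- case: s => P K p kap proj cs /=; set a := chain_map X h.
  have [Q [q [projQ dq]]] := enough_projectives (X _ h).
  have [B] := biproduct_ex P Q.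
  have dp' := copair_deflation B (a ∘ p) dq.
  case: (dp') => K' [kap' ck'].
  exists (ProjCover (projective_biproduct (B := B) proj projQ) ck') => /=.
  have [C [c cc]] := chain_infl X h.
  have dc : deflation c by exists (X k (ltnW h)), a.
  have [L [lam cl]] := deflation_comp dq dc.
  have [|sg esg] := kernel_lift (f := q ∘ lam) (conf_kernel cc).
    by rewrite -compmA (conf_zero cl).
  have K0 : a ∘ (p ∘ (bip_fst B ∘ kap')) + q ∘ (bip_snd B ∘ kap') = 0.
    by rewrite -(conf_zero ck') compDl !compmA.
  have [|t et] := kernel_lift (f := bip_snd B ∘ kap') (conf_kernel cl).
    move: K0 => /(congr1 (compm c)); rewrite compDr -compmA (conf_zero cc).
    by rewrite comp0l add0r comp0r compmA.
  have pb : is_pullback p (- sg) (bip_fst B ∘ kap') t.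
    have E0 : p ∘ (bip_fst B ∘ kap') = - sg ∘ t.
      apply: (kernel_mono (conf_kernel cc)); rewrite compNl compNr.
      rewrite -[_ ∘ (sg ∘ _)]compmA esg compmA et.
      by apply/eqP; rewrite -addr_eq0 K0.
    split=> // T y z e.
    have [|w ew] := kernel_lift (f := bpair B y (lam ∘ z)) (conf_kernel ck').
      rewrite copair_pair -compmA -esg !compmA e compNl compNr addrC.
      exact: subrr.
    exists w; split.
      split; first by rewrite compmA ew fst_pair.
      apply: (kernel_mono (conf_kernel cl)).
      by rewrite -compmA et compmA ew snd_pair.
    move=> w' [e1 e2]; apply: (kernel_mono (conf_kernel ck')); rewrite ew.
    apply: bip_mono; first by rewrite fst_pair -e1 compmA.
    by rewrite snd_pair -e2 -compmA et compmA.
  have [n [cn en]] := pullback_conf pb cs.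
  exists (bip_inl B), n; split.
  + by exists Q, (bip_snd B); apply: bip_conf.
  + by exists L, t.
  + apply: bip_mono.
      by rewrite -compmA bip_fst_inl comp1m -en compmA.
    by rewrite -compmA bip_snd_inl comp0l -compmA -et compmA (conf_zero cn) comp0r.
  + by rewrite copair_inl.
have [m em] := map_ex es; have [n en] := map_ex em.
have im k (h : (k < l)%N) : inflation (m k h) by case: (en k h).
have ine k (h : (k < l)%N) : inflation (n k h) by case: (en k h).
pose P := @MChain F l (fun k h => pc_P (s k h)) m im.
pose K := @MChain F l (fun k h => pc_K (s k h)) n ine.
have cp k (h : (k < l)%N) : chain_map X h ∘ pc_p (s k (ltnW h)) =
   pc_p (s _ h) ∘ chain_map P h by case: (en k h).
have ci k (h : (k < l)%N) : chain_map P h ∘ pc_k (s k (ltnW h)) =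
   pc_k (s _ h) ∘ chain_map K h by case: (en k h).
exists P, K, (@Ladder F l P X (fun k h => pc_p (s k h)) cp),
  (@Ladder F l K P (fun k h => pc_k (s k h)) ci); split=> k h.
  exact: pc_proj.
exact: pc_conf.
Qed.

Lemma mor_injective_term X : @injective_obj (mor_exact F l) X ->
  forall k (h : (k <= l)%N), injective_obj (X k h).
Proof.
move=> inj k h; have [I [Z [i [p [iI c]]]]] := mor_enough_injectives X.
have [|r er] := inj X I i (idm (X : mor_exact F l)).
  by exists Z, p.
exact: (injective_retract (ladder_eq h er) (iI k h)).
Qed.

Lemma mor_projective_term X : @projective (mor_exact F l) X ->
  forall k (h : (k <= l)%N), projective (X k h).
Proof.
move=> inj k h; have [I [Z [p [i [iI c]]]]] := mor_enough_projectives X.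
have [|r er] := inj I X p (idm (X : mor_exact F l)).
  by exists Z, i.
exact: (projective_retract (ladder_eq h er) (iI k h)).
Qed.

Definition mor_frob : frobcat.
refine (@FrobCat (mor_exact F l) _ _ _).
- move=> X; have [P [K [p [i [proj c]]]]] := mor_enough_projectives X.
  by exists P, p; split; [exact: projective_chain | exists K, i].
- move=> X; have [I [Z [i [p [inj c]]]]] := mor_enough_injectives X.
  by exists I, i; split; [exact: injective_chain | exists Z, p].
- move=> X; split=> [/mor_projective_term hX | /mor_injective_term hX].
    by apply: injective_chain => k h; apply/projective_injective/hX.
  by apply: projective_chain => k h; apply/projective_injective/hX.
Defined.

End MorFrobenius.

Section Stable.
Variable F : frobcat.
Implicit Types X Y Z : F.

Definition stably_zero X Y (f : X ~> Y) :=
  exists (P : F) (u : X ~> P) (v : P ~> Y), projective P /\ f = v ∘ u.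

Definition proj_ideal X Y (f : X ~> Y) : bool := `[< stably_zero f >].

Lemma proj_ideal_closed X Y : zmod_closed (@proj_ideal X Y).
Proof.
split=> [|f g /asboolP [P [u [v [hP ->]]]] /asboolP [Q [u' [v' [hQ ->]]]]].
  have [P [p [hP _]]] := enough_projectives Y.
  by apply/asboolP; exists P, 0, p; rewrite comp0r.
have [B] := biproduct_ex P Q; apply/asboolP.
exists B, (bpair B u u'), (bcopair B v (- v')); split.
  exact: projective_biproduct.
by rewrite copair_pair compNl.
Qed.

HB.instance Definition _ X Y :=
  GRing.isZmodClosed.Build (X ~> Y) (@proj_ideal X Y) (proj_ideal_closed X Y).

Definition stab_ideal X Y : zmodClosed (X ~> Y) :=
  GRing.ZmodClosed.clone (X ~> Y) (@proj_ideal X Y) _.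

Definition stab_hom X Y : zmodType := Quotient.quot (stab_ideal X Y).

Definition cl X Y (f : X ~> Y) : stab_hom X Y := (\pi f)%qT.

Lemma cl_eq X Y (f g : X ~> Y) : cl f = cl g <-> stably_zero (f - g).
Proof.
split=> [/eqP|h].
  by rewrite /cl -Quotient.idealrBE => /asboolP.
by apply/eqP; rewrite /cl -Quotient.idealrBE; apply/asboolP.
Qed.


Lemma cl_surj X Y (f : stab_hom X Y) : exists f0 : X ~> Y, f = cl f0.
Proof. by exists (repr f); rewrite /cl reprK. Qed.

Lemma cl0 X Y : cl (0 : X ~> Y) = 0. Proof. by rewrite /cl piE. Qed.
Lemma clD X Y (f g : X ~> Y) : cl (f + g) = cl f + cl g.
Proof. by rewrite /cl !piE. Qed.
Lemma clN X Y (f : X ~> Y) : cl (- f) = - cl f.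
Proof. by rewrite /cl !piE. Qed.
Lemma clB X Y (f g : X ~> Y) : cl (f - g) = cl f - cl g.
Proof. by rewrite clD clN. Qed.

Lemma cl_eq0 X Y (f : X ~> Y) : cl f = 0 <-> stably_zero f.
Proof. by rewrite -(cl0 X Y) cl_eq subr0. Qed.

Lemma stably_zero_l X Y Z (g : Y ~> Z) (f : X ~> Y) :
  stably_zero f -> stably_zero (g ∘ f).
Proof. by move=> [P [u [v [hP ->]]]]; exists P, u, (g ∘ v); rewrite compmA. Qed.

Lemma stably_zero_r X Y Z (g : Y ~> Z) (f : X ~> Y) :
  stably_zero g -> stably_zero (g ∘ f).
Proof. by move=> [P [u [v [hP ->]]]]; exists P, (u ∘ f), v; rewrite compmA. Qed.

Definition stab_comp X Y Z (g : stab_hom Y Z) (f : stab_hom X Y) : stab_hom X Z :=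
  cl (repr g ∘ repr f).

Lemma stab_compE X Y Z (g : Y ~> Z) (f : X ~> Y) :
  stab_comp (cl g) (cl f) = cl (g ∘ f).
Proof.
have /cl_eq hg : cl (repr (cl g)) = cl g by rewrite {1}/cl reprK.
have /cl_eq hf : cl (repr (cl f)) = cl f by rewrite {1}/cl reprK.
rewrite /stab_comp; set g' := repr (cl g) in hg *; set f' := repr (cl f) in hf *.
apply/eqP; rewrite -subr_eq0 -clB; apply/eqP.
have -> : g' ∘ f' - g ∘ f = (g' - g) ∘ f' + g ∘ (f' - f).
  by rewrite compBl compBr addrA subrK.
rewrite clD; have /cl_eq0 -> := stably_zero_r f' hg.
by have /cl_eq0 -> := stably_zero_l g hf; rewrite addr0.
Qed.

Definition stab_pre : preaddcat.
refine (@PreAddCat F stab_hom (fun X => cl (idm X)) stab_comp _ _ _ _ _).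
- move=> X Y Z T h g f; have [h0 ->] := cl_surj h; have [g0 ->] := cl_surj g.
  by have [f0 ->] := cl_surj f; rewrite !stab_compE compmA.
- by move=> X Y f; have [f0 ->] := cl_surj f; rewrite stab_compE comp1m.
- by move=> X Y f; have [f0 ->] := cl_surj f; rewrite stab_compE compm1.
- move=> X Y Z g g' f; have [g0 ->] := cl_surj g; have [g1 ->] := cl_surj g'.
  by have [f0 ->] := cl_surj f; rewrite -clD !stab_compE compDl clD.
- move=> X Y Z g f f'; have [g0 ->] := cl_surj g; have [f0 ->] := cl_surj f.
  by have [f1 ->] := cl_surj f'; rewrite -clD !stab_compE compDr clD.
Defined.

Lemma stab_zero_ex : exists Z : stab_pre, is_zero Z.
Proof.
have [Z zZ] := zero_ex F; exists Z.
by rewrite /is_zero /= zZ cl0.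
Qed.

Lemma stab_biproduct_ex (X Y : stab_pre) : inhabited (biproduct X Y).
Proof.
move: X Y => X Y; have [B] := @biproduct_ex F X Y.
exists; refine (@Biproduct stab_pre X Y B (cl (bip_inl B)) (cl (bip_inr B))
  (cl (bip_fst B)) (cl (bip_snd B)) _ _ _ _ _); rewrite /= ?stab_compE.
- by rewrite bip_fst_inl.
- by rewrite bip_snd_inr.
- by rewrite bip_fst_inr cl0.
- by rewrite bip_snd_inl cl0.
- by rewrite -clD bip_sum.
Qed.

Definition stab_add : addcat := AddCat stab_zero_ex stab_biproduct_ex.

End Stable.

Record tricat := TriCat {
  tri_add :> addcat;
  shift : tri_add -> tri_add;
  shiftm : forall X Y : tri_add, X ~> Y -> shift X ~> shift Y;
  distinguished : forall X Y Z : tri_add, X ~> Y -> Y ~> Z -> Z ~> shift X -> Prop;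
  shiftm_id : forall X, shiftm (idm X) = idm (shift X);
  shiftm_comp : forall X Y Z (g : Y ~> Z) (f : X ~> Y),
    shiftm (g ∘ f) = shiftm g ∘ shiftm f;
  shiftmD : forall X Y (f g : X ~> Y), shiftm (f + g) = shiftm f + shiftm g;
  shiftm_bij : forall X Y (g : shift X ~> shift Y),
    exists! f : X ~> Y, shiftm f = g;
  shift_ess_surj : forall Y, exists X, isomorphic (shift X) Y;
  dist_isom : forall X Y Z X' Y' Z' (u : X ~> Y) (v : Y ~> Z) (w : Z ~> shift X)
    (u' : X' ~> Y') (v' : Y' ~> Z') (w' : Z' ~> shift X')
    (a : X ~> X') (b : Y ~> Y') (c : Z ~> Z'),
    is_iso a -> is_iso b -> is_iso c ->
    b ∘ u = u' ∘ a -> c ∘ v = v' ∘ b -> shiftm a ∘ w = w' ∘ c ->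
    distinguished u v w -> distinguished u' v' w';
  dist_id : forall X Z, is_zero Z ->
    distinguished (idm X) (0 : X ~> Z) (0 : Z ~> shift X);
  dist_cone : forall X Y (u : X ~> Y), exists Z (v : Y ~> Z) (w : Z ~> shift X),
    distinguished u v w;
  dist_rot : forall X Y Z (u : X ~> Y) (v : Y ~> Z) (w : Z ~> shift X),
    distinguished u v w <-> distinguished v w (- shiftm u);
  dist_map : forall X Y Z X' Y' Z' (u : X ~> Y) (v : Y ~> Z) (w : Z ~> shift X)
    (u' : X' ~> Y') (v' : Y' ~> Z') (w' : Z' ~> shift X')
    (a : X ~> X') (b : Y ~> Y'),
    distinguished u v w -> distinguished u' v' w' -> b ∘ u = u' ∘ a ->
    exists c : Z ~> Z', c ∘ v = v' ∘ b /\ shiftm a ∘ w = w' ∘ c;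
  dist_octa : forall X Y Z A B C (u : X ~> Y) (v : Y ~> Z)
    (i : Y ~> A) (i' : A ~> shift X) (j : Z ~> C) (j' : C ~> shift Y)
    (k : Z ~> B) (k' : B ~> shift X),
    distinguished u i i' -> distinguished v j j' -> distinguished (v ∘ u) k k' ->
    exists (f : A ~> B) (g : B ~> C),
      [/\ distinguished f g (shiftm i ∘ j'),
          f ∘ i = k ∘ v, k' ∘ f = i', g ∘ k = j & j' ∘ g = shiftm u ∘ k'] }.

Section Shift.
Variable F : frobcat.
Implicit Types X Y Z : F.
Local Notation S := (stab_add F).

Record cosyzygy_seq X := CosyzygySeq {
  cs_I : F; cs_S : F; cs_i : X ~> cs_I; cs_p : cs_I ~> cs_S;
  cs_inj : injective_obj cs_I; cs_conf : conflation cs_i cs_p }.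

Lemma cosyzygy_ex X : exists s : cosyzygy_seq X, True.
Proof.
have [I [i [inj [Z [p c]]]]] := enough_injectives X.
by exists (CosyzygySeq inj c).
Qed.

(* A fixed choice of conflations X -> I(X) -> Sigma X with I(X) injective; the
   maps are [iota X] and [ppi X]. *)
Definition cosyzygy X : cosyzygy_seq X := projT1 (cid (cosyzygy_ex X)).
Definition ihull X : F := cs_I (cosyzygy X).
Definition susp X : F := cs_S (cosyzygy X).
Definition iota X : X ~> ihull X := cs_i (cosyzygy X).
Definition ppi X : ihull X ~> susp X := cs_p (cosyzygy X).
Lemma susp_conf X : conflation (iota X) (ppi X). Proof. exact: cs_conf. Qed.
Lemma ihull_inj X : injective_obj (ihull X). Proof. exact: cs_inj. Qed.
Lemma ihull_proj X : projective (ihull X).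
Proof. by apply/projective_injective/ihull_inj. Qed.
Lemma iota_infl X : inflation (iota X). Proof. by exists (susp X), (ppi X); apply: susp_conf. Qed.
Lemma ppi_defl X : deflation (ppi X). Proof. by exists X, (iota X); apply: susp_conf. Qed.

Lemma stably_zero_infl X Y Z (i : X ~> Y) (f : X ~> Z) : inflation i ->
  stably_zero f -> exists e : Y ~> Z, e ∘ i = f.
Proof.
move=> ii [P [u [v [/projective_injective hP ->]]]].
by have [g eg] := hP _ _ i u ii; exists (v ∘ g); rewrite compmA eg.
Qed.

Lemma stably_zero_defl X Y Z (p : Y ~> Z) (f : X ~> Z) : deflation p ->
  stably_zero f -> exists e : X ~> Y, p ∘ e = f.
Proof.
move=> ii [P [u [v [hP ->]]]].
by have [g eg] := hP _ _ p v ii; exists (g ∘ u); rewrite -compmA eg.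
Qed.

Lemma thru_proj X Y P (v : P ~> Y) (u : X ~> P) : projective P -> cl (v ∘ u) = 0.
Proof. by move=> hP; apply/cl_eq0; exists P, u, v. Qed.

Definition susp_rel X Y (f : X ~> Y) (b : susp X ~> susp Y) :=
  exists a : ihull X ~> ihull Y, a ∘ iota X = iota Y ∘ f /\ b ∘ ppi X = ppi Y ∘ a.

Lemma susp_rel_ex X Y (f : X ~> Y) : exists b, susp_rel f b.
Proof.
have [a ea] := @ihull_inj Y _ _ _ (iota Y ∘ f) (iota_infl X).
have [|b eb] := coker_desc (f := ppi Y ∘ a) (conf_cokernel (susp_conf X)).
  by rewrite compmA ea -compmA (conf_zero (susp_conf Y)) comp0l.
by exists b, a.
Qed.

Lemma susp_rel_cl X Y (f f' : X ~> Y) b b' : susp_rel f b -> susp_rel f' b' ->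
  cl f = cl f' -> cl b = cl b'.
Proof.
move=> [a [e1 e2]] [a' [e1' e2']] /cl_eq h.
have [g eg] := stably_zero_infl (iota_infl X) h.
have [|m em] := coker_desc (f := a - a' - iota Y ∘ g) (conf_cokernel (susp_conf X)).
  by rewrite !compBl e1 e1' compmA eg compBr subrr.
apply/cl_eq; exists (ihull Y), m, (ppi Y); split; first exact: ihull_proj.
apply: (coker_epi (conf_cokernel (susp_conf X))).
rewrite compmA em compBl e2 e2' !compBr -[ppi Y ∘ (iota Y ∘ g)]compmA.
by rewrite (conf_zero (susp_conf Y)) comp0l subr0.
Qed.

Definition scl (X Y : F) (f : X ~> Y) : (X : S) ~> (Y : S) := cl f.

Lemma scl_surj (X Y : S) (f : X ~> Y) : exists f0 : hom (p := F) X Y, f = scl f0.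
Proof. exact: cl_surj. Qed.

Lemma scl_comp X Y Z (g : Y ~> Z) (f : X ~> Y) : scl g ∘ scl f = scl (g ∘ f).
Proof. exact: stab_compE. Qed.
Lemma scl_id X : scl (idm X) = idm (X : S). Proof. by []. Qed.
Lemma scl0 X Y : scl (0 : X ~> Y) = 0. Proof. exact: cl0. Qed.
Lemma sclD X Y (f g : X ~> Y) : scl (f + g) = scl f + scl g.
Proof. exact: clD. Qed.
Lemma sclN X Y (f : X ~> Y) : scl (- f) = - scl f. Proof. exact: clN. Qed.
Lemma sclB X Y (f g : X ~> Y) : scl (f - g) = scl f - scl g.
Proof. exact: clB. Qed.
Lemma scl_eq X Y (f g : X ~> Y) : scl f = scl g <-> stably_zero (f - g).
Proof. exact: cl_eq. Qed.
Lemma scl_eq0 X Y (f : X ~> Y) : scl f = 0 <-> stably_zero f.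
Proof. exact: cl_eq0. Qed.
Lemma scl_thru X Y P (v : P ~> Y) (u : X ~> P) : projective P -> scl (v ∘ u) = 0.
Proof. exact: thru_proj. Qed.

Definition suspm (X Y : S) (f : X ~> Y) : (susp X : S) ~> (susp Y : S) :=
  scl (projT1 (cid (susp_rel_ex (repr (f : stab_hom X Y))))).

Lemma suspmE X Y (f : X ~> Y) b : susp_rel f b -> suspm (scl f) = scl b.
Proof.
move=> h; apply: susp_rel_cl (projT2 (cid _)) h _.
by rewrite {1}/cl reprK.
Qed.

Lemma suspm_id (X : S) : suspm (idm X) = idm (susp X : S).
Proof.
rewrite -[LHS]/(suspm (scl (idm (X : F)))) -[RHS]/(scl (idm (susp X))).
apply: suspmE; exists (idm _).
by rewrite !compm1 !comp1m.
Qed.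

Lemma suspm_comp (X Y Z : S) (g : Y ~> Z) (f : X ~> Y) :
  suspm (g ∘ f) = suspm g ∘ suspm f.
Proof.
have [g0 ->] := scl_surj g; have [f0 ->] := scl_surj f.
have [b hb] := susp_rel_ex f0; have [b' hb'] := susp_rel_ex g0.
rewrite (suspmE hb) (suspmE hb') !scl_comp; apply: suspmE.
case: hb hb' => a [e1 e2] [a' [e1' e2']]; exists (a' ∘ a); split.
  by rewrite compmA e1 -compmA e1' compmA.
by rewrite compmA e2 -compmA e2' compmA.
Qed.

Lemma suspmD (X Y : S) (f g : X ~> Y) : suspm (f + g) = suspm f + suspm g.
Proof.
have [g0 ->] := scl_surj g; have [f0 ->] := scl_surj f.
have [b hb] := susp_rel_ex f0; have [b' hb'] := susp_rel_ex g0.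
rewrite (suspmE hb) (suspmE hb') -!sclD; apply: suspmE.
case: hb hb' => a [e1 e2] [a' [e1' e2']]; exists (a + a'); split.
  by rewrite compDl e1 e1' compDr.
by rewrite compDl e2 e2' compDr.
Qed.

Lemma suspm0 (X Y : S) : suspm (0 : X ~> Y) = 0.
Proof. by apply: (addrI (suspm 0)); rewrite -suspmD !addr0. Qed.
Lemma suspmN (X Y : S) (f : X ~> Y) : suspm (- f) = - suspm f.
Proof. by apply: (addrI (suspm f)); rewrite -suspmD !subrr suspm0. Qed.

Lemma suspm_full (X Y : S) (g : (susp X : S) ~> (susp Y : S)) :
  exists f : X ~> Y, suspm f = g.
Proof.
have [b ->] := scl_surj g.
have [a ea] := @ihull_proj X _ _ (ppi Y) (b ∘ ppi X) (ppi_defl Y).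
have [|f ef] := kernel_lift (f := a ∘ iota X) (conf_kernel (susp_conf Y)).
  by rewrite -compmA ea compmA (conf_zero (susp_conf X)) comp0r.
by exists (scl f); apply: suspmE; exists a.
Qed.

Lemma suspm_faithful0 (X Y : S) (f : X ~> Y) : suspm f = 0 -> f = 0.
Proof.
have [f0 ->] := scl_surj f; have [b hb] := susp_rel_ex f0.
rewrite (suspmE hb) => /scl_eq0 /(stably_zero_defl (ppi_defl Y)) [e ee].
case: hb => a [e1 e2].
have [|m em] := kernel_lift (f := a - e ∘ ppi X) (conf_kernel (susp_conf Y)).
  by rewrite compBr -e2 -compmA ee subrr.
apply/scl_eq0; exists (ihull X), (iota X), m; split; first exact: ihull_proj.
apply: (kernel_mono (conf_kernel (susp_conf Y))).
by rewrite -compmA em compBl e1 compmA (conf_zero (susp_conf X)) comp0r subr0.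
Qed.

Lemma suspm_faithful (X Y : S) (f g : X ~> Y) : suspm f = suspm g -> f = g.
Proof.
move=> e; apply/eqP; rewrite -subr_eq0; apply/eqP/suspm_faithful0.
by rewrite suspmD suspmN e subrr.
Qed.

(* The connecting morphism of a conflation X -> Y -> Z is taken without a sign:
   it is the map on cokernels induced by an extension Y -> I(X) of X -> I(X).
   The opposite convention replaces w by - w in every triangle. *)
Definition standard X Y Z (i : X ~> Y) (p : Y ~> Z) (w : Z ~> susp X) :=
  conflation i p /\
  exists h : Y ~> ihull X, h ∘ i = iota X /\ w ∘ p = ppi X ∘ h.

Definition stab_dist (X Y Z : S) (u : X ~> Y) (v : Y ~> Z)
    (w : Z ~> (susp X : S)) :=
  exists (X' Y' Z' : F) (i : X' ~> Y') (p : Y' ~> Z') (d : Z' ~> susp X')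
    (a : X ~> (X' : S)) (b : Y ~> (Y' : S)) (c : Z ~> (Z' : S)),
    [/\ standard i p d, is_iso a, is_iso b & is_iso c] /\
    [/\ b ∘ u = scl i ∘ a, c ∘ v = scl p ∘ b & suspm a ∘ w = scl d ∘ c].

Lemma standard_ex X Y Z (i : X ~> Y) (p : Y ~> Z) : conflation i p ->
  exists w, standard i p w.
Proof.
move=> c; have ii : inflation i by exists Z, p.
have [h eh] := @ihull_inj X _ _ _ (iota X) ii.
have [|w ew] := coker_desc (f := ppi X ∘ h) (conf_cokernel c).
  by rewrite compmA eh (conf_zero (susp_conf X)).
by exists w; split=> //; exists h.
Qed.

Lemma standard_dist X Y Z (i : X ~> Y) (p : Y ~> Z) (w : Z ~> susp X) :
  standard i p w -> stab_dist (scl i) (scl p) (scl w).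
Proof.
move=> st; exists X, Y, Z, i, p, w, (idm _), (idm _), (idm _).
split; first by split=> //; exact: is_iso_id.
by split; rewrite ?suspm_id comp1m compm1.
Qed.

Lemma standard_nat X Y Z X' Y' Z' (i : X ~> Y) (p : Y ~> Z) (w : Z ~> susp X)
    (i' : X' ~> Y') (p' : Y' ~> Z') (w' : Z' ~> susp X')
    (a : X ~> X') (b : Y ~> Y') (c : Z ~> Z') :
  standard i p w -> standard i' p' w' -> b ∘ i = i' ∘ a -> c ∘ p = p' ∘ b ->
  suspm (scl a) ∘ scl w = scl w' ∘ scl c.
Proof.
move=> [k [h [h1 h2]]] [k' [h' [h1' h2']]] e1 e2.
have [s hs] := susp_rel_ex a; rewrite (suspmE hs) !scl_comp.
case: hs => a' [ea es].
have [|r er] := coker_desc (f := a' ∘ h - h' ∘ b) (conf_cokernel k).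
  by rewrite compBl !compmA h1 ea e1 -compmA h1' subrr.
apply/scl_eq; exists (ihull X'), r, (ppi X'); split; first exact: ihull_proj.
apply: (coker_epi (conf_cokernel k)).
rewrite compBl !compmA h2 e2 er compBr -!compmA es h2' //.
Qed.

Lemma standard_map X Y Z X' Y' Z' (i : X ~> Y) (p : Y ~> Z) (w : Z ~> susp X)
    (i' : X' ~> Y') (p' : Y' ~> Z') (w' : Z' ~> susp X')
    (a : (X : S) ~> (X' : S)) (b : (Y : S) ~> (Y' : S)) :
  standard i p w -> standard i' p' w' -> b ∘ scl i = scl i' ∘ a ->
  exists c : (Z : S) ~> (Z' : S),
    c ∘ scl p = scl p' ∘ b /\ suspm a ∘ scl w = scl w' ∘ c.
Proof.
have [f ->] := scl_surj a; have [g ->] := scl_surj b.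
move=> st st'; have [k _] := st; have [k' _] := st'.
have ii : inflation i by exists Z, p.
move=> E; have /scl_eq h : scl (g ∘ i) = scl (i' ∘ f) by rewrite -!scl_comp.
case: h => P [n [m [hP e]]].
have [n' en] := (projective_injective P).1 hP _ _ i n ii.
pose g' := g - m ∘ n'.
have eg : scl g = scl g' by rewrite sclB scl_thru // subr0.
have e' : g' ∘ i = i' ∘ f.
  by rewrite compBl compmA en -e opprB addrC subrK.
have [|c ec] := coker_desc (f := p' ∘ g') (conf_cokernel k).
  by rewrite compmA e' -compmA (conf_zero k') comp0l.
exists (scl c); split; first by rewrite eg !scl_comp ec.
exact: standard_nat st st' e' ec.
Qed.

Lemma sq_inv (C : preaddcat) (X Y X' Y' : C) (u : X ~> Y) (u' : X' ~> Y')
    (a : X ~> X') (b : Y ~> Y') (a' : X' ~> X) (b' : Y' ~> Y) :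
  is_inverse a a' -> is_inverse b b' -> b ∘ u = u' ∘ a -> b' ∘ u' = u ∘ a'.
Proof.
move=> [a1 a2] [b1 b2] e.
by rewrite -[LHS]compm1 -a2 compmA -(compmA u') -e -!compmA b1 comp1m.
Qed.

Lemma suspm_inverse (X Y : S) (f : X ~> Y) (g : Y ~> X) :
  is_inverse f g -> is_inverse (suspm f) (suspm g).
Proof. by move=> [a b]; split; rewrite -suspm_comp ?a ?b suspm_id. Qed.

Lemma suspm_iso (X Y : S) (f : X ~> Y) : is_iso f -> is_iso (suspm f).
Proof. by move=> [g h]; exists (suspm g); apply: suspm_inverse. Qed.

Lemma inverse_sym (C : preaddcat) (X Y : C) (f : X ~> Y) (g : Y ~> X) :
  is_inverse f g -> is_inverse g f.
Proof. by case. Qed.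

Lemma stab_dist_pull (X Y Z X' Y' Z' : S) (u : X ~> Y) (v : Y ~> Z)
    (w : Z ~> (susp X : S)) (u' : X' ~> Y') (v' : Y' ~> Z')
    (w' : Z' ~> (susp X' : S)) (a : X ~> X') (b : Y ~> Y') (c : Z ~> Z') :
  is_iso a -> is_iso b -> is_iso c ->
  b ∘ u = u' ∘ a -> c ∘ v = v' ∘ b -> suspm a ∘ w = w' ∘ c ->
  stab_dist u' v' w' -> stab_dist u v w.
Proof.
move=> ia ib ic e1 e2 e3
  [X0 [Y0 [Z0 [i [p [d [a0 [b0 [c0 [[st ia0 ib0 ic0] [f1 f2 f3]]]]]]]]]]].
exists X0, Y0, Z0, i, p, d, (a0 ∘ a), (b0 ∘ b), (c0 ∘ c); split.
  by split=> //; exact: is_iso_comp.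
split.
- by rewrite compmA e1 -compmA f1 compmA.
- by rewrite compmA e2 -compmA f2 compmA.
- by rewrite suspm_comp compmA e3 -compmA f3 compmA.
Qed.

Lemma stab_dist_isom (X Y Z X' Y' Z' : S) (u : X ~> Y) (v : Y ~> Z)
    (w : Z ~> (susp X : S)) (u' : X' ~> Y') (v' : Y' ~> Z')
    (w' : Z' ~> (susp X' : S)) (a : X ~> X') (b : Y ~> Y') (c : Z ~> Z') :
  is_iso a -> is_iso b -> is_iso c ->
  b ∘ u = u' ∘ a -> c ∘ v = v' ∘ b -> suspm a ∘ w = w' ∘ c ->
  stab_dist u v w -> stab_dist u' v' w'.
Proof.
move=> [a' ha] [b' hb] [c' hc] e1 e2 e3.
apply: (@stab_dist_pull _ _ _ _ _ _ _ _ _ _ _ _ a' b' c').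
- by exists a; apply: inverse_sym.
- by exists b; apply: inverse_sym.
- by exists c; apply: inverse_sym.
- exact: sq_inv ha hb e1.
- exact: sq_inv hb hc e2.
- exact: sq_inv hc (suspm_inverse ha) e3.
Qed.

Lemma zero_iso (C : preaddcat) (X Y : C) : is_zero X -> is_zero Y -> is_iso (0 : X ~> Y).
Proof. by move=> zX zY; exists 0; split; rewrite comp0l. Qed.

Lemma stab_dist_id (X Z : S) : is_zero Z ->
  stab_dist (idm X) (0 : X ~> Z) (0 : Z ~> (susp X : S)).
Proof.
move=> zZ; have [O zO] := zero_ex F.
have st : standard (idm (X : F)) (0 : (X : F) ~> O) 0.
  split; first exact: zero_conf_l.
  by exists (iota X); rewrite compm1 comp0l (conf_zero (susp_conf X)).
have zO' : is_zero (O : S) by rewrite /is_zero -scl_id zO scl0.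
exists X, X, O, (idm (X : F)), 0, 0, (idm _), (idm _), 0; split.
  by split=> //; [exact: is_iso_id | exact: is_iso_id | exact: zero_iso].
by split; rewrite ?scl_id ?scl0 ?comp0l ?comp0r ?compm1.
Qed.

Lemma bip_inl_iso (X P : F) (B : biproduct X P) : projective P ->
  is_inverse (scl (bip_inl B)) (scl (bip_fst B)).
Proof.
move=> hP; split; rewrite scl_comp; first by rewrite bip_fst_inl.
rewrite -scl_id -(bip_sum B) sclD [X in _ + X]scl_thru ?addr0 //.
Qed.

Lemma inl_pair (X P T : F) (B : biproduct X P) (f : T ~> X) (g : T ~> P) :
  projective P -> scl (bip_inl B) ∘ scl f = scl (bpair B f g).
Proof. by move=> hP; rewrite scl_comp sclD [X in _ + X]scl_thru ?addr0. Qed.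

Lemma stab_dist_cone (X Y : S) (u : X ~> Y) :
  exists (Z : S) (v : Y ~> Z) (w : Z ~> (susp X : S)), stab_dist u v w.
Proof.
have [u0 ->] := scl_surj u.
have [B] := @biproduct_ex F Y (ihull X).
have [Z [p c]] := pair_inflation B u0 (iota_infl X).
have [w st] := standard_ex c.
exists Z, (scl p ∘ scl (bip_inl B)), (scl w).
exists X, (bip_obj B), Z, (bpair B u0 (iota X)), p, w, (idm _), (scl (bip_inl B)), (idm _).
have ib := bip_inl_iso B (@ihull_proj X).
split; first by split=> //; [exact: is_iso_id | exists (scl (bip_fst B)) | exact: is_iso_id].
split; last by rewrite suspm_id compm1 comp1m.
  by rewrite compm1; apply/inl_pair/ihull_proj.
by rewrite comp1m.
Qed.

Lemma standard_rot X Y Z (i : X ~> Y) (p : Y ~> Z) (w : Z ~> susp X) :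
  standard i p w -> stab_dist (scl p) (scl w) (- suspm (scl i)).
Proof.
move=> [c [h [h1 h2]]].
have [B] := @biproduct_ex F Z (ihull X).
have d : deflation (bcopair B w (- ppi X)).
  apply: copair_deflation.
  apply: (deflation_iso (a := - idm _) (b := idm _) _ (is_iso_id _) _ (ppi_defl X)).
    by exists (- idm _); split; rewrite compNl compNr comp1m opprK.
  by rewrite compNl compNr compm1 comp1m opprK.
have k : is_kernel (bpair B p h) (bcopair B w (- ppi X)).
  split=> [|T f]; first by rewrite copair_pair h2 compNl subrr.
  rewrite -[f in bcopair _ _ _ ∘ f]comp1m -(bip_sum B) compDl !compmA.
  rewrite -/(bpair B (bip_fst B ∘ f) (bip_snd B ∘ f)) copair_pair compNl.
  move: {2}(bip_fst B ∘ f) (erefl (bip_fst B ∘ f)) => z ez.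
  move: {2}(bip_snd B ∘ f) (erefl (bip_snd B ∘ f)) => x ex.
  rewrite ez ex => /eqP.
  rewrite subr_eq0 => /eqP e.
  have [P [g [q [pb dq]]]] := deflation_pullback (p := p) z (ex_intro _ X (ex_intro _ i c)).
  have [j [cj ej]] := pullback_conf pb c.
  have [|m em] := kernel_lift (f := h ∘ g - x ∘ q) (conf_kernel (susp_conf X)).
    by rewrite compBr -compmA -h2 compmA pb.1 -compmA e !compmA subrr.
  have [|y ey] := coker_desc (f := g - i ∘ m) (conf_cokernel cj).
    rewrite compBl ej compmA.
    suff -> : m ∘ j = idm X by rewrite compm1 subrr.
    apply: (kernel_mono (conf_kernel (susp_conf X))).
    by rewrite -compmA em compBl !compmA ej (conf_zero cj) comp0r subr0 h1 compm1.
  exists y; split.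
    apply: bip_mono; rewrite -compmA ?fst_pair ?snd_pair ?ez ?ex;
    apply: (coker_epi (conf_cokernel cj)).
      by rewrite compmA ey compBr -compmA (conf_zero c) comp0l subr0 pb.1.
    rewrite compmA ey compBr -(compmA h) h1 em opprB addrC subrK //.
  move=> y' ey'.
  have inj T' (t : T' ~> Y) : bpair B p h ∘ t = 0 -> t = 0.
    rewrite pair_comp => e0.
    have e1 : p ∘ t = 0 by rewrite -(fst_pair B (p ∘ t) (h ∘ t)) e0 comp0r.
    have e2 : h ∘ t = 0 by rewrite -(snd_pair B (p ∘ t) (h ∘ t)) e0 comp0r.
    have [r er] := kernel_lift (conf_kernel c) e1.
    rewrite -er (kernel_mono0 (f := r) (conf_kernel (susp_conf X))) ?comp0r //.
    by rewrite -h1 compmA er.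
  apply/eqP; rewrite -subr_eq0; apply/eqP/inj.
  rewrite compBr ey'; apply/eqP; rewrite subr_eq0; apply/eqP.
  apply: bip_mono; rewrite -compmA ?fst_pair ?snd_pair ?ez ?ex;
    apply: (coker_epi (conf_cokernel cj)).
    by rewrite compmA ey compBr -compmA (conf_zero c) comp0l subr0 pb.1.
  by rewrite compmA ey compBr -(compmA h) h1 em opprB addrC subrK.
have cf := kernel_conf k d.
have [b hb] := susp_rel_ex i; case: (hb) => a [e1 e2].
have [|m em] := coker_desc (f := iota Y - a ∘ h) (conf_cokernel c).
  by rewrite compBl compmA h1 e1 subrr.
have st : standard (bpair B p h) (bcopair B w (- ppi X)) (- b).
  split=> //; exists (bcopair B m a); split.
    by rewrite copair_pair em subrK.
  rewrite !comp_copair !compNl compNr opprK e2; congr (bcopair _ _ _).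
  apply: (coker_epi (conf_cokernel c)).
  rewrite compNl !compmA h2 em compBr (conf_zero (susp_conf Y)) sub0r.
  by rewrite -!compmA e2.
have := standard_dist st.
apply: (stab_dist_pull (a := idm _) (b := scl (bip_inl B)) (c := idm _)).
- exact: is_iso_id.
- by exists (scl (bip_fst B)); apply/bip_inl_iso/ihull_proj.
- exact: is_iso_id.
- by rewrite compm1; apply/inl_pair/ihull_proj.
- by rewrite comp1m scl_comp copair_inl.
- by rewrite suspm_id comp1m compm1 (suspmE hb) sclN.
Qed.

Lemma stab_dist_rot (X Y Z : S) (u : X ~> Y) (v : Y ~> Z) (w : Z ~> (susp X : S)) :
  stab_dist u v w -> stab_dist v w (- suspm u).
Proof.
move=> [X0 [Y0 [Z0 [i [p [d [a [b [c [[st ia ib ic] [e1 e2 e3]]]]]]]]]]].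
apply: (stab_dist_pull (c := suspm a) ib ic (suspm_iso ia) e2 e3) (standard_rot st).
by rewrite compNl compNr -!suspm_comp e1.
Qed.

Lemma iso_mono0 (C : preaddcat) (X Y T : C) (f : X ~> Y) (g : T ~> X) :
  is_iso f -> f ∘ g = 0 -> g = 0.
Proof. by move=> [f' [h _]] e; rewrite -[g]comp1m -h compmA e comp0r. Qed.

Lemma iso_lift (C : preaddcat) (X Y T : C) (f : X ~> Y) (g : T ~> Y) :
  is_iso f -> exists g', f ∘ g' = g.
Proof. by move=> [f' [_ h]]; exists (f' ∘ g); rewrite -compmA h comp1m. Qed.

Lemma stab_dist_comp0 (X Y Z : S) (u : X ~> Y) (v : Y ~> Z) (w : Z ~> (susp X : S)) :
  stab_dist u v w -> v ∘ u = 0.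
Proof.
move=> [X0 [Y0 [Z0 [i [p [d [a [b [c [[[k _] ia ib ic] [e1 e2 e3]]]]]]]]]]].
apply: (iso_mono0 ic); rewrite -compmA e2 compmA e1 -compmA scl_comp.
by rewrite (conf_zero k) scl0 comp0l.
Qed.

Lemma stab_dist_exact (X Y Z : S) (u : X ~> Y) (v : Y ~> Z) (w : Z ~> (susp X : S))
    (T : S) (f : T ~> Y) :
  stab_dist u v w -> v ∘ f = 0 -> exists g : T ~> X, u ∘ g = f.
Proof.
move=> [X0 [Y0 [Z0 [i [p [d [a [b [c [[[k _] ia ib ic] [e1 e2 e3]]]]]]]]]]] e.
have [f0 ef0] := scl_surj (b ∘ f).
have : scl p ∘ scl f0 = 0.
  by rewrite -ef0 -compmA -e2 compmA e comp0r.
rewrite scl_comp => /scl_eq0 h.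
case: h => P [m [n [hP en]]].
have [n' en'] := hP _ _ p n (ex_intro _ X0 (ex_intro _ i k)).
have [|g eg] := kernel_lift (f := f0 - n' ∘ m) (conf_kernel k).
  by rewrite compBr -compmA en' en subrr.
have [g' eg'] := iso_lift (scl g) ia.
exists g'; apply/eqP; rewrite -subr_eq0; apply/eqP/(iso_mono0 ib).
rewrite compBr -compmA e1 compmA eg' scl_comp eg ef0 sclB (scl_thru n' m hP).
by rewrite subr0 subrr.
Qed.

Lemma stab_triangle_five (X Y Z X' Y' Z' : S) (u : X ~> Y) (v : Y ~> Z)
    (w : Z ~> (susp X : S)) (u' : X' ~> Y') (v' : Y' ~> Z')
    (w' : Z' ~> (susp X' : S)) (a : X ~> X') (b : Y ~> Y') (c : Z ~> Z') :
  stab_dist u v w -> stab_dist u' v' w' -> is_iso a -> is_iso b ->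
  b ∘ u = u' ∘ a -> c ∘ v = v' ∘ b -> suspm a ∘ w = w' ∘ c -> is_iso c.
Proof.
move=> t t' ia ib e1 e2 e3.
have inj T (x : T ~> Z) : c ∘ x = 0 -> x = 0.
  move=> h; have : w ∘ x = 0.
    by apply: (iso_mono0 (suspm_iso ia)); rewrite -compmA e3 compmA h comp0r.
  move=> /(stab_dist_exact (stab_dist_rot t)) [y ey].
  have /(stab_dist_exact t') [z ez] : v' ∘ (b ∘ y) = 0.
    by rewrite -compmA -e2 compmA ey.
  have [z' ez'] := iso_lift z ia.
  have ey' : y = u ∘ z'.
    apply/eqP; rewrite -subr_eq0; apply/eqP/(iso_mono0 ib).
    by rewrite compBr -compmA e1 compmA ez' ez subrr.
  by rewrite -ey ey' -compmA (stab_dist_comp0 t) comp0l.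
have sur T (y : T ~> Z') : exists x, c ∘ x = y.
  have [s es] := iso_lift (w' ∘ y) (suspm_iso ia).
  have su0 : suspm u ∘ s = 0.
    apply: (iso_mono0 (suspm_iso ib)).
    rewrite -compmA -suspm_comp e1 suspm_comp compmA es -compmA.
    apply/eqP; rewrite -oppr_eq0 -!compNl; apply/eqP.
    by rewrite (stab_dist_comp0 (stab_dist_rot (stab_dist_rot t'))) comp0l.
  have [x ex] : exists x, w ∘ x = s.
    apply: (stab_dist_exact (stab_dist_rot (stab_dist_rot t))).
    by rewrite compNl su0 oppr0.
  have [|q eq] := stab_dist_exact (f := c ∘ x - y) (stab_dist_rot t').
    by rewrite compBr -compmA -e3 compmA ex es subrr.
  have [q' eq'] := iso_lift q ib.
  exists (x - v ∘ q').
  by rewrite compBr -(compmA c) e2 compmA eq' eq opprB addrC subrK.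
have [c' ec'] := sur Z' (idm Z'); exists c'; split=> //.
apply/eqP; rewrite -subr_eq0; apply/eqP/inj.
by rewrite compBr -compmA ec' comp1m compm1 subrr.
Qed.

Lemma stab_dist_map (X Y Z X' Y' Z' : S) (u : X ~> Y) (v : Y ~> Z)
    (w : Z ~> (susp X : S)) (u' : X' ~> Y') (v' : Y' ~> Z')
    (w' : Z' ~> (susp X' : S)) (a : X ~> X') (b : Y ~> Y') :
  stab_dist u v w -> stab_dist u' v' w' -> b ∘ u = u' ∘ a ->
  exists c : Z ~> Z', c ∘ v = v' ∘ b /\ suspm a ∘ w = w' ∘ c.
Proof.
move=> [X0 [Y0 [Z0 [i [p [d [a0 [b0 [c0 [[st [a0' ia] [b0' ib] ic] [e1 e2 e3]]]]]]]]]]].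
move=> [X1 [Y1 [Z1 [i' [p' [d' [a1 [b1 [c1
  [[st' [a1' ia1] ib1 [c1' ic1]] [f1 f2 f3]]]]]]]]]]] e.
have [|k [k1 k2]] := standard_map (a := a1 ∘ (a ∘ a0')) (b := b1 ∘ (b ∘ b0')) st st'.
  rewrite !compmA (sq_inv ia ib e1) -(compmA b) e (compmA u') -(compmA b1) f1.
  by rewrite !compmA.
exists (c1' ∘ (k ∘ c0)); split.
  rewrite !compmA e2 -(compmA k) k1 !compmA ib.1 compm1 -(compmA (scl p')) -f2.
  by rewrite !compmA -(compmA c1') ic1.1 comp1m.
rewrite -!compmA -(sq_inv ic1 (suspm_inverse ia1) f3) !compmA -(compmA (scl d')) -k2.
rewrite !suspm_comp !compmA -e3 -(compmA (suspm a0')) -(compmA (suspm a1')).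
by rewrite -!suspm_comp ia1.1 ia.1 !suspm_id !comp1m.
Qed.

Lemma stab_dist_rot_inv (X Y Z : S) (u : X ~> Y) (v : Y ~> Z)
    (w : Z ~> (susp X : S)) :
  stab_dist v w (- suspm u) -> stab_dist u v w.
Proof.
move=> t; have [Z' [v' [w' t']]] := stab_dist_cone u.
have r3 := stab_dist_rot (stab_dist_rot t).
have r3' := stab_dist_rot (stab_dist_rot (stab_dist_rot t')).
have [|th [e1 e2]] := stab_dist_map (a := idm _) (b := idm _) r3 r3'.
  by rewrite comp1m compm1.
have [c ec] := suspm_full th; rewrite -{th}ec in e1 e2.
have cv : c ∘ v = v'.
  apply: suspm_faithful; rewrite suspm_comp.
  by apply: oppr_inj; rewrite -compNr e1 compm1.
have wc : w = w' ∘ c.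
  apply: suspm_faithful; rewrite suspm_comp.
  by apply: oppr_inj; rewrite -compNl -e2 suspm_id comp1m.
have ic : is_iso c.
  have [c2 [h1 h2]] : is_iso (suspm c).
    apply: (stab_triangle_five r3 r3' (is_iso_id _) (is_iso_id _) _ e1 e2).
    by rewrite comp1m compm1.
  have [c' ec'] := suspm_full c2; exists c'.
  by split; apply: suspm_faithful; rewrite suspm_comp ec' suspm_id.
apply: (stab_dist_pull (is_iso_id X) (is_iso_id Y) ic) t'.
- by rewrite comp1m compm1.
- by rewrite compm1.
- by rewrite suspm_id comp1m.
Qed.

Lemma susp_ess_surj (Y : S) : exists X : S, isomorphic (susp X : S) Y.
Proof.
have [P [p [hP [K [k c]]]]] := enough_projectives (Y : F).
exists K.
have [w st] := standard_ex c.
have t := stab_dist_rot (standard_dist st).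
have zP : is_zero (P : S).
  by rewrite /is_zero -scl_id -[idm P]compm1 scl_thru.
have [|g eg] := stab_dist_exact (f := idm (susp K : S)) (stab_dist_rot t).
  by rewrite [scl k](zero_to _ zP) suspm0 oppr0 comp0l.
exists g, (scl w); split=> //; apply/eqP; rewrite -subr_eq0; apply/eqP.
have [|z <-] := stab_dist_exact (f := g ∘ scl w - idm (Y : S)) t.
  by rewrite compBr -compmA eg comp1m compm1 subrr.
by rewrite [scl p](zero_from _ zP) comp0l.
Qed.

Lemma stab_octa_ex (X Y Z : S) (u : X ~> Y) (v : Y ~> Z) :
  exists (A B C : S) (i : Y ~> A) (i' : A ~> (susp X : S)) (j : Z ~> C)
    (j' : C ~> (susp Y : S)) (k : Z ~> B) (k' : B ~> (susp X : S))
    (f : A ~> B) (g : B ~> C),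
    [/\ stab_dist u i i', stab_dist v j j' & stab_dist (v ∘ u) k k'] /\
    [/\ stab_dist f g (suspm i ∘ j'),
          f ∘ i = k ∘ v, k' ∘ f = i', g ∘ k = j & j' ∘ g = suspm u ∘ k'].
Proof.
have [u0 ->] := scl_surj u; have [v0 ->] := scl_surj v.
have [D1] := @biproduct_ex F Y (ihull X).
pose u1 := bpair D1 u0 (iota X).
have [A [pA cA]] : inflation u1 := pair_inflation D1 u0 (iota_infl X).
have [D2] := @biproduct_ex F Z (ihull D1).
pose v1 := bpair D2 (v0 ∘ bip_fst D1) (iota D1).
have iv1 : inflation v1 := pair_inflation D2 _ (iota_infl D1).
have iu1 : inflation u1 by exists A, pA.
case: (iv1) => C [pC cC]; have [B [pB cB]] := inflation_comp iu1 iv1.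
have [wA sA] := standard_ex cA; have [wB sB] := standard_ex cB.
have [wC sC] := standard_ex cC.
have [|f ef] := coker_desc (f := pB ∘ v1) (conf_cokernel cA).
  by rewrite compmA (conf_zero cB).
have [g [cfg eg]] := noether cA cC cB ef.
have [wD sD] := standard_ex cfg.
have b1 := bip_inl_iso D1 (@ihull_proj X).
have b2 := bip_inl_iso D2 (@ihull_proj D1).
have s1 : scl (bip_inl D1) ∘ scl u0 = scl u1 by apply/inl_pair/ihull_proj.
have s2 : scl (bip_inl D2) ∘ (scl v0 ∘ scl (bip_fst D1)) = scl v1.
  by rewrite scl_comp; apply/inl_pair/ihull_proj.
have s2' : scl (bip_inl D2) ∘ scl v0 = scl v1 ∘ scl (bip_inl D1).
  by rewrite -s2 !compmA b1.1 compm1.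
have i1 := is_iso_id.
have j1 : is_iso (scl (bip_inl D1)) by exists (scl (bip_fst D1)).
have j2 : is_iso (scl (bip_inl D2)) by exists (scl (bip_fst D2)).
exists A, B, C, (scl pA ∘ scl (bip_inl D1)), (scl wA),
  (scl pC ∘ scl (bip_inl D2)), (suspm (scl (bip_fst D1)) ∘ scl wC),
  (scl pB ∘ scl (bip_inl D2)), (scl wB), (scl f), (scl g); split; split.
- apply: (stab_dist_pull (a := idm _) (i1 _ _) j1 (i1 _ _)) (standard_dist sA).
  + by rewrite compm1.
  + by rewrite comp1m.
  + by rewrite suspm_id comp1m compm1.
- apply: (stab_dist_pull j1 j2 (i1 _ _)) (standard_dist sC).
  + exact: s2'.
  + by rewrite comp1m.
  + by rewrite compm1 -compmA -suspm_comp b1.2 suspm_id comp1m.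
- apply: (stab_dist_pull (a := idm _) (i1 _ _) j2 (i1 _ _)) (standard_dist sB).
  + by rewrite compm1 -compmA s2' compmA s1 scl_comp.
  + by rewrite comp1m.
  + by rewrite suspm_id comp1m compm1.
- have := standard_dist sD.
  suff -> : suspm (scl pA ∘ scl (bip_inl D1)) ∘ (suspm (scl (bip_fst D1)) ∘ scl wC)
      = scl wD by [].
  rewrite suspm_comp compmA -(compmA (suspm (scl (bip_inl D1)))) -suspm_comp.
  rewrite b1.2 suspm_id comp1m.
  rewrite (standard_nat (b := pB) (c := idm _) sC sD); last by rewrite comp1m.
    by rewrite scl_id compm1.
  by rewrite ef.
- by rewrite -compmA scl_comp ef -scl_comp !compmA -s2'.
- have := standard_nat (a := idm _) (b := v1) (c := f) sA sB.
  rewrite scl_id suspm_id comp1m => <- //.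
  by rewrite compm1.
- by rewrite -compmA scl_comp eg.
- have := standard_nat (a := u1) (b := idm _) (c := g) sB sC.
  rewrite compmA comp1m compm1 => <- //.
  by rewrite -compmA -suspm_comp -s1 -compmA b1.1 comp1m.
Qed.

Lemma stab_octa (X Y Z A B C : S) (u : X ~> Y) (v : Y ~> Z)
    (i : Y ~> A) (i' : A ~> (susp X : S)) (j : Z ~> C)
    (j' : C ~> (susp Y : S)) (k : Z ~> B) (k' : B ~> (susp X : S)) :
  stab_dist u i i' -> stab_dist v j j' -> stab_dist (v ∘ u) k k' ->
  exists (f : A ~> B) (g : B ~> C),
    [/\ stab_dist f g (suspm i ∘ j'),
        f ∘ i = k ∘ v, k' ∘ f = i', g ∘ k = j & j' ∘ g = suspm u ∘ k'].
Proof.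
move=> tA tC tB; have [A0 [B0 [C0 [i0 [i0' [j0 [j0' [k0 [k0' [f [g
  [[tA0 tC0 tB0] [t e1 e2 e3 e4]]]]]]]]]]]]] := stab_octa_ex u v.
have cone_iso (X' Y' Z1 Z2 : S) (x : X' ~> Y') (y : Y' ~> Z1)
    (z : Z1 ~> (susp X' : S)) (y' : Y' ~> Z2) (z' : Z2 ~> (susp X' : S)) :
    stab_dist x y z -> stab_dist x y' z' ->
    exists (c : Z1 ~> Z2) (c' : Z2 ~> Z1),
      [/\ is_inverse c c', c ∘ y = y' & z' ∘ c = z].
  move=> t1 t2; have [|c [h1 h2]] := stab_dist_map (a := idm _) (b := idm _) t1 t2.
    by rewrite comp1m compm1.
  have [|c' hc] := stab_triangle_five t1 t2 (is_iso_id _) (is_iso_id _) _ h1 h2.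
    by rewrite comp1m compm1.
  exists c, c'; split=> //; first by rewrite h1 compm1.
  by rewrite -h2 suspm_id comp1m.
have [a [a' [ha a1 a2]]] := cone_iso _ _ _ _ _ _ _ _ _ tA0 tA.
have [b [b' [hb b1 b2]]] := cone_iso _ _ _ _ _ _ _ _ _ tB0 tB.
have [c [c' [hc c1 c2]]] := cone_iso _ _ _ _ _ _ _ _ _ tC0 tC.
have a1' : a' ∘ i = i0 by rewrite -a1 -compmA ha.1 comp1m.
have b1' : b' ∘ k = k0 by rewrite -b1 -compmA hb.1 comp1m.
exists (b ∘ (f ∘ a')), (c ∘ (g ∘ b')); split.
- apply: (stab_dist_isom (a := a) (b := b) (c := c)) t.
  + by exists a'.
  + by exists b'.
  + by exists c'.
  + by rewrite !compmA ha.1 compm1.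
  + by rewrite !compmA hb.1 compm1.
  + by rewrite -compmA -suspm_comp a1 compmA c2.
- by rewrite !compmA a1' e1 -compmA b1.
- by rewrite -compmA b2 -compmA e2 -a2 compmA ha.2 compm1.
- by rewrite !compmA b1' e3 c1.
- rewrite -compmA c2 -compmA e4 -b2 !compmA hb.2 compm1 //.
Qed.

Definition stable : tricat.
refine (@TriCat S susp suspm stab_dist _ _ _ _ _ _ _ _ _ _ _).
- exact: suspm_id.
- exact: suspm_comp.
- exact: suspmD.
- move=> X Y g; have [f ef] := suspm_full g; exists f; split=> // f' ef'.
  by apply: suspm_faithful; rewrite ef'.
- exact: susp_ess_surj.
- by move=> *; apply: stab_dist_isom; eassumption.
- exact: stab_dist_id.
- exact: stab_dist_cone.
- by move=> X Y Z u v w; split; [exact: stab_dist_rot | exact: stab_dist_rot_inv].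
- exact: stab_dist_map.
- exact: stab_octa.
Defined.
End Shift.

Record triangulated_subcategory (T : tricat) (P : T -> Prop) : Prop :=
  TriangulatedSubcategory {
    trisub_zero : exists Z : T, is_zero Z /\ P Z;
    trisub_isom : forall X Y : T, isomorphic X Y -> P X -> P Y;
    trisub_shift : forall X : T, P (shift X) <-> P X;
    trisub_cone : forall (X Y Z : T) (u : X ~> Y) (v : Y ~> Z) (w : Z ~> shift X),
      distinguished u v w -> P X -> P Y -> P Z }.

Definition semiorthogonal_decomposition (T : tricat) (U V : T -> Prop) : Prop :=
  [/\ triangulated_subcategory U,
      triangulated_subcategory V,
      forall (X Y : T) (f : X ~> Y), U X -> V Y -> f = 0
    & forall X : T, exists (A B : T) (u : A ~> X) (v : X ~> B) (w : B ~> shift A),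
        [/\ U A, V B & distinguished u v w]].

Definition stable_mono (F : frobcat) (l : nat) : tricat := stable (mor_frob F l).

(* [is_identity f] also asserts that the two ends of f are the same object. *)
Inductive is_identity (C : preaddcat) (X : C) : forall Y : C, X ~> Y -> Prop :=
  IsIdentity : is_identity (idm X).

Definition Gamma (F : frobcat) (l s t : nat) : stable_mono F l -> Prop :=
  fun X : mchain F l =>
    forall (k : nat) (h : (k <= l)%N), (k < s)%N || (t < k)%N -> projective (X k h).

Definition Delta (F : frobcat) (l s t : nat) : stable_mono F l -> Prop :=
  fun X => exists Y : mchain F l, isomorphic X (Y : stable_mono F l) /\
    forall (k : nat) (h : (k < l)%N), (s <= k < t)%N -> is_identity (chain_map Y h).

Arguments Gamma F l s t : clear implicits.
Arguments Delta F l s t : clear implicits.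

(* Main.v *)
(* Write X^{-1} = 0 and let [a, b] be an interval of indices. Replacing all the
   terms of X in this interval by X^a gives a functor R on chains with a natural
   map R X -> X; it is a stable isomorphism if X is stably constant on [a, b], and
   R Y is projective if Y is projective outside ]a, b]. Hence a morphism X -> Y
   between such chains factors stably through R Y = 0, and the cone of R X -> X is
   projective outside ]a, b]. This is (c), and also (a), with a = -1. Replacing
   the terms by X^b instead gives a natural map X -> R X, hence (b).
   A ladder is a stable isomorphism as soon as its terms are, since its cone is then
   termwise projective, so a chain is stably constant on [a, b] iff it lies in
   Delta^[a, b]. *)
Require Import Defs.
From mathcomp Require Import all_boot.
From mathcomp Require Import ssralg boolp zify.
Set Implicit Arguments.
Unset Strict Implicit.
Unset Printing Implicit Defensive.
Import GRing.Theory.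
Local Open Scope ring_scope.

(** * Cancellation of isomorphisms *)

Lemma iso_cancel_l (C : preaddcat) (X Y Z : C) (g : Y ~> Z) (f : X ~> Y) :
  is_iso g -> is_iso (g ∘ f) -> is_iso f.
Proof.
move=> [g' [gl gr]] [h [hl hr]]; exists (h ∘ g); split; first by rewrite compmA.
have e : g ∘ (f ∘ (h ∘ g)) = g by rewrite -!compmA hr comp1m.
by rewrite -[LHS]comp1m -[in LHS]gl compmA e.
Qed.

Lemma iso_cancel_r (C : preaddcat) (X Y Z : C) (g : Y ~> Z) (f : X ~> Y) :
  is_iso f -> is_iso (g ∘ f) -> is_iso g.
Proof.
by move=> hf hgf; apply/iso_op/(iso_cancel_l (op_iso hf))/(op_iso hgf).
Qed.

Lemma iso_conj (C : preaddcat) (X Y X' Y' : C) (f : X ~> Y) (f' : X' ~> Y')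
    (a : X ~> X') (b : Y ~> Y') :
  is_iso a -> is_iso b -> b ∘ f = f' ∘ a -> is_iso f -> is_iso f'.
Proof.
by move=> ia ib e hf; apply: (iso_cancel_r ia); rewrite -e; apply: is_iso_comp.
Qed.

(** * Isomorphisms, zero objects and triangles in a stable category *)

Section StableCategory.
Variable F : frobcat.
Local Notation S := (stab_add F).

Lemma suspm_reflects_iso (X Y : S) (f : X ~> Y) : is_iso (suspm f) -> is_iso f.
Proof.
move=> [g' [gl gr]]; have [g eg] := suspm_full g'; exists g.
by split; apply: suspm_faithful; rewrite suspm_comp eg suspm_id.
Qed.

(** If the identity of [X] factors through a projective, then [X] is a retract of that
    projective. *)
Lemma is_zero_projective (X : F) : is_zero (X : S) <-> projective X.
Proof.
split=> [/scl_eq0 [P [u [v [hP e]]]] | hX].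
  exact: projective_retract (esym e) hP.
by rewrite /is_zero -scl_id -[idm X]comp1m scl_thru.
Qed.

(** Invertibility of [u] kills both [v] and [w]. As [w = 0], the identity of [Z] factors through
    [v = 0]. *)
Lemma dist_iso_zero (X Y Z : S) (u : X ~> Y) (v : Y ~> Z)
    (w : Z ~> (susp X : S)) : stab_dist u v w -> is_iso u -> is_zero Z.
Proof.
move=> t iu; have tr := stab_dist_rot t.
have w0 : w = 0.
  apply: (iso_mono0 (suspm_iso iu)); apply/eqP; rewrite -oppr_eq0 -compNl.
  by rewrite (stab_dist_comp0 (stab_dist_rot tr)).
have v0 : v = 0.
  case: iu => u' [_ uu]; rewrite -[v]compm1 -uu -compmA (stab_dist_comp0 t).
  exact: comp0l.
have [|g] := stab_dist_exact (f := idm Z) tr; first by rewrite w0 comp0l.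
by rewrite v0 comp0l /is_zero => <-.
Qed.

(** The five lemma concerns the third map of a morphism of triangles, so the triangle of [idm X] is
    compared with the given one after two rotations; the third map is then [suspm u]. *)
Lemma dist_zero_iso (X Y Z : S) (u : X ~> Y) (v : Y ~> Z)
    (w : Z ~> (susp X : S)) : stab_dist u v w -> is_zero Z -> is_iso u.
Proof.
move=> t zZ; apply: suspm_reflects_iso.
have t2 := stab_dist_rot (stab_dist_rot t).
have t1 := stab_dist_rot (stab_dist_rot (stab_dist_id X zZ)).
apply: (stab_triangle_five t1 t2 (is_iso_id Z) (is_iso_id _)).
- by rewrite [LHS](zero_from _ zZ) [RHS](zero_from _ zZ).
- by rewrite suspm_id compNr !compm1.
- rewrite suspm_id suspm0 oppr0 comp0r compNl -suspm_comp.
  by rewrite [v](zero_to _ zZ) comp0l suspm0 oppr0.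
Qed.

Lemma is_zero_susp (X : S) : is_zero (susp X : S) -> is_zero X.
Proof.
by move=> h; apply: suspm_faithful; rewrite suspm_id suspm0.
Qed.

Section Conflation.
Variables (X Y Z : F) (i : X ~> Y) (p : Y ~> Z).
Hypothesis c : conflation i p.

Lemma conf_infl_iso_zero : is_iso (scl i) -> is_zero (Z : S).
Proof. by have [w /standard_dist t] := standard_ex c; exact: dist_iso_zero t. Qed.

Lemma conf_defl_iso_zero : is_iso (scl p) -> is_zero (X : S).
Proof.
have [w /standard_dist t] := standard_ex c => ip.
exact/is_zero_susp/(dist_iso_zero (stab_dist_rot t)).
Qed.

Lemma conf_projective_coker : projective X -> projective Y -> projective Z.
Proof.
move=> /is_zero_projective zX /is_zero_projective zY.
apply/is_zero_projective/conf_infl_iso_zero.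
by rewrite [scl i](zero_from _ zX); exact: zero_iso.
Qed.

Lemma conf_projective_ker : projective Y -> projective Z -> projective X.
Proof.
move=> /is_zero_projective zY /is_zero_projective zZ.
apply/is_zero_projective/conf_defl_iso_zero.
by rewrite [scl p](zero_from _ zY); exact: zero_iso.
Qed.

Variables (X' Y' Z' : F) (i' : X' ~> Y') (p' : Y' ~> Z').
Hypothesis c' : conflation i' p'.
Variables (f : X ~> X') (g : Y ~> Y') (h : Z ~> Z').
Hypotheses (eg : g ∘ i = i' ∘ f) (eh : h ∘ p = p' ∘ g).

Lemma conf_five_coker : is_iso (scl f) -> is_iso (scl g) -> is_iso (scl h).
Proof.
have [w st] := standard_ex c; have [w' st'] := standard_ex c' => iF iG.
apply: (stab_triangle_five (standard_dist st) (standard_dist st') iF iG).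
- by rewrite !scl_comp eg.
- by rewrite !scl_comp eh.
- exact: standard_nat st st' eg eh.
Qed.

(** In the rotated triangles the suspension of [f] is the third map, and suspension reflects
    isomorphisms. *)
Lemma conf_five_ker : is_iso (scl g) -> is_iso (scl h) -> is_iso (scl f).
Proof.
have [w st] := standard_ex c; have [w' st'] := standard_ex c' => iG iH.
apply: suspm_reflects_iso.
apply: (stab_triangle_five (stab_dist_rot (standard_dist st))
  (stab_dist_rot (standard_dist st')) iG iH).
- by rewrite !scl_comp eh.
- exact: standard_nat st st' eg eh.
- by rewrite compNl compNr -!suspm_comp !scl_comp eg.
Qed.

End Conflation.

(** Adding an injective summand to [Y] turns [f] into an inflation without changing it stably. The
    cone thus becomes a cokernel, which for chains can be computed term by term. *)
Lemma cone_conflation (X Y : F) (f : X ~> Y) :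
  exists (Y' Z : F) (j : Y ~> Y') (i : X ~> Y') (p : Y' ~> Z)
    (v : (Y : S) ~> (Z : S)) (w : (Z : S) ~> (susp X : S)),
    [/\ conflation i p, is_iso (scl j), scl j ∘ scl f = scl i
      & stab_dist (scl f) v w].
Proof.
have [B] := @biproduct_ex F Y (ihull X).
have [Z [p c]] := pair_inflation B f (iota_infl X).
have [w st] := standard_ex c.
have ib := bip_inl_iso B (@ihull_proj F X).
have iB : is_iso (scl (bip_inl B)) by exists (scl (bip_fst B)).
have e : scl (bip_inl B) ∘ scl f = scl (bpair B f (Defs.iota X)).
  exact/inl_pair/ihull_proj.
exists (bip_obj B), Z, (bip_inl B), (bpair B f (Defs.iota X)), p,
  (scl p ∘ scl (bip_inl B)), (scl w); split=> //.
apply: (stab_dist_pull (is_iso_id (X : S)) iB (is_iso_id _)) (standard_dist st).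
- by rewrite compm1.
- by rewrite comp1m.
- by rewrite suspm_id comp1m compm1.
Qed.

(** Dually, a projective summand added to [X] turns [f] into a deflation, and its kernel completes
    [f] to a triangle on the left. *)
Lemma cocone_conflation (X Y : F) (f : X ~> Y) :
  exists (X' Z : F) (j : X ~> X') (i : Z ~> X') (p : X' ~> Y)
    (u : (Z : S) ~> (X : S)) (w : (Y : S) ~> (susp Z : S)),
    [/\ conflation i p, is_iso (scl j), scl p ∘ scl j = scl f
      & stab_dist u (scl f) w].
Proof.
have [P [q [hP dq]]] := enough_projectives Y.
have [B] := @biproduct_ex F X P.
have [Z [i c]] := copair_deflation B f dq.
have [w st] := standard_ex c.
have ib := bip_inl_iso B hP.
have iB : is_iso (scl (bip_inl B)) by exists (scl (bip_fst B)).
have e : scl (bcopair B f q) ∘ scl (bip_inl B) = scl f.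
  by rewrite scl_comp copair_inl.
exists (bip_obj B), Z, (bip_inl B), i, (bcopair B f q),
  (scl (bip_fst B) ∘ scl i), (scl w); split=> //.
apply: (stab_dist_pull (is_iso_id (Z : S)) iB (is_iso_id _)) (standard_dist st).
- by rewrite -compmA ib.2 comp1m compm1.
- by rewrite comp1m.
- by rewrite suspm_id comp1m compm1.
Qed.

(** The suspension of [X] is the cokernel of an inflation into a projective, and every distinguished
    triangle is isomorphic to one given by a conflation. Closure under conflations therefore yields
    closure under shifts in both directions and under cones. *)
Lemma triangulated_subcategory_conf (P : F -> Prop) :
  (forall X Y : F, isomorphic (X : S) (Y : S) -> P X -> P Y) ->
  (forall X : F, projective X -> P X) ->
  (forall (X Y Z : F) (i : X ~> Y) (p : Y ~> Z), conflation i p ->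
     P X -> P Y -> P Z) ->
  (forall (X Y Z : F) (i : X ~> Y) (p : Y ~> Z), conflation i p ->
     P Y -> P Z -> P X) ->
  @triangulated_subcategory (stable F) P.
Proof.
move=> Piso Pproj Pcok Pker; split=> //.
- have [Z zZ] := zero_ex S; exists Z; split=> //.
  exact/Pproj/is_zero_projective.
- move=> X; have PI := Pproj _ (@ihull_proj F X).
  by split=> PX; [apply: Pker (susp_conf _) _ _ | apply: Pcok (susp_conf X) _ _].
- move=> X Y Z u v w.
  move=> [X' [Y' [Z' [i [p [d [a [b [c [[[k _] ia ib [c' hc]] _]]]]]]]]]] PX PY.
  apply: (Piso Z'); first by exists c', c; apply: inverse_sym.
  by apply: Pcok k _ _; [apply: Piso PX; exists a | apply: Piso PY; exists b].
Qed.

End StableCategory.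

(** * Composites of consecutive maps of a chain *)

Section Composite.
Variables (E : exactcat) (l : nat).
Implicit Types X Y Z : mchain E l.

(** A term depends on its index and on the proof of its bound; this is the identity transported
    along equalities of both. *)
Definition chain_cast X i j (e : i = j) : forall (hi : (i <= l)%N) (hj : (j <= l)%N),
    X i hi ~> X j hj :=
  match e in _ = j return forall (hi : (i <= l)%N) (hj : (j <= l)%N), X i hi ~> X j hj
  with erefl => fun hi hj =>
    match bool_irrelevance hi hj in _ = h return X i hi ~> X i h with
    | erefl => idm (X i hi)
    end
  end.

(* The junk value for j < i is 0. *)
Fixpoint chain_comp X i (hi : (i <= l)%N) j : forall hj : (j <= l)%N, X i hi ~> X j hj :=
  match j return forall hj : (j <= l)%N, X i hi ~> X j hj with
  | 0 => fun hj =>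
      match @eqP _ i 0%N with
      | ReflectT e => chain_cast X e hi hj
      | ReflectF _ => 0
      end
  | j'.+1 => fun hj =>
      match @eqP _ i j'.+1 with
      | ReflectT e => chain_cast X e hi hj
      | ReflectF _ => chain_map X hj ∘ chain_comp X hi (ltnW hj)
      end
  end.

Lemma chain_comp_id X i (hi : (i <= l)%N) : chain_comp X hi hi = idm (X i hi).
Proof.
have K (e : i = i) : chain_cast X e hi hi = idm (X i hi).
  by rewrite (Prop_irrelevance e erefl) /= (Prop_irrelevance (bool_irrelevance hi hi) erefl).
by case: i hi K => [|i] hi K /=; case: eqP.
Qed.

Lemma chain_compS X i j (hi : (i <= l)%N) (hj : (j < l)%N) : (i <= j)%N ->
  chain_comp X hi hj = chain_map X hj ∘ chain_comp X hi (ltnW hj).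
Proof. by move=> ij /=; case: eqP => // e; exfalso; rewrite e ltnn in ij. Qed.

(** The two ends are syntactically different objects when [i = j] is only propositional, so
    [is_identity] replaces an equation with [idm]. *)
Lemma chain_comp_is_identity X i j (hi : (i <= l)%N) (hj : (j <= l)%N) :
  i = j -> is_identity (chain_comp X hi hj).
Proof. by move=> e; case: _ / e in hj *; rewrite (bool_irrelevance hj hi) chain_comp_id. Qed.

Lemma chain_comp_map X i (hi : (i < l)%N) :
  chain_comp X (ltnW hi) hi = chain_map X hi.
Proof. by rewrite chain_compS // chain_comp_id compm1. Qed.

Lemma chain_comp_trans X i j k (hi : (i <= l)%N) (hj : (j <= l)%N) (hk : (k <= l)%N) :
  (i <= j)%N -> (j <= k)%N ->
  chain_comp X hj hk ∘ chain_comp X hi hj = chain_comp X hi hk.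
Proof.
move=> ij; elim: k hk => [|k IH] hk; rewrite leq_eqVlt => /orP[/eqP e|jk //].
- by case: _ / e in hk *; rewrite (bool_irrelevance hk hj) chain_comp_id comp1m.
- by case: _ / e in hk *; rewrite (bool_irrelevance hk hj) chain_comp_id comp1m.
- by rewrite !chain_compS ?compmA ?IH // (leq_trans ij).
Qed.

Lemma chain_comp_natural X Y (f : ladder X Y) i j (hi : (i <= l)%N) (hj : (j <= l)%N) :
  (i <= j)%N -> chain_comp Y hi hj ∘ f i hi = f j hj ∘ chain_comp X hi hj.
Proof.
elim: j hj => [|j IH] hj; rewrite leq_eqVlt => /orP[/eqP e|ij //].
- by case: _ / e in hj *; rewrite (bool_irrelevance hj hi) !chain_comp_id comp1m compm1.
- by case: _ / e in hj *; rewrite (bool_irrelevance hj hi) !chain_comp_id comp1m compm1.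
- by rewrite !chain_compS // compmA IH // -!compmA ladder_comm.
Qed.

Lemma chain_comp_inflation X i j (hi : (i <= l)%N) (hj : (j <= l)%N) :
  (i <= j)%N -> inflation (chain_comp X hi hj).
Proof.
elim: j hj => [|j IH] hj; rewrite leq_eqVlt => /orP[/eqP e|ij //].
- by case: _ / e in hj *; rewrite (bool_irrelevance hj hi) chain_comp_id; apply: inflation_id.
- by case: _ / e in hj *; rewrite (bool_irrelevance hj hi) chain_comp_id; apply: inflation_id.
- by rewrite chain_compS //; apply: inflation_comp (chain_infl X hj); apply: IH.
Qed.

End Composite.

(** * Chains augmented by a zero object on the left *)

Section Augmentation.
Variables (E : exactcat) (l : nat).
Implicit Types X Y Z : mchain E l.

Definition zero_ob : E := projT1 (cid (zero_ex E)).
Lemma zero_obP : is_zero zero_ob. Proof. exact: (projT2 (cid (zero_ex E))). Qed.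

(* The chain 0 -> X^0 -> ... -> X^l, so that X^k has index k.+1. *)
Definition aug_ob X k : (k <= l.+1)%N -> E :=
  match k with 0 => fun _ => zero_ob | k'.+1 => fun h => X k' h end.

(** [chain_comp] accepts any proofs of the bounds, whereas the source of [chain_map] fixes one;
    hence the composite of length one. *)
Definition aug_map X k : forall h : (k < l.+1)%N, aug_ob X (ltnW h) ~> aug_ob X h :=
  match k return forall h : (k < l.+1)%N, aug_ob X (ltnW h) ~> aug_ob X h with
  | 0 => fun _ => 0
  | k'.+1 => fun h => @chain_comp E l X k' (ltnW h) k'.+1 h
  end.

Lemma aug_infl X k (h : (k < l.+1)%N) : inflation (aug_map X h).
Proof.
case: k h => [|k] h /=; first by exists (X 0%N h), (idm _); exact/zero_conf_r/zero_obP.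
exact: chain_comp_inflation.
Qed.

Definition aug X : mchain E l.+1 := MChain (@aug_infl X).

Definition aug_ladder_map X Y (f : ladder X Y) k :
    forall h : (k <= l.+1)%N, aug X k h ~> aug Y k h :=
  match k return forall h : (k <= l.+1)%N, aug X k h ~> aug Y k h with
  | 0 => fun _ => 0
  | k'.+1 => fun h => f k' h
  end.

Lemma aug_ladder_comm X Y (f : ladder X Y) k (h : (k < l.+1)%N) :
  chain_map (aug Y) h ∘ aug_ladder_map f (ltnW h) =
  aug_ladder_map f h ∘ chain_map (aug X) h.
Proof.
case: k h => [|k] h; last first.
  exact: (@chain_comp_natural E l X Y f k k.+1 (ltnW h) h (leqnSn k)).
by rewrite /= comp0l comp0r.
Qed.

Definition aug_ladder X Y (f : ladder X Y) : ladder (aug X) (aug Y) :=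
  Ladder (aug_ladder_comm f).

Lemma aug_conflation X Y Z (i : ladder X Y) (p : ladder Y Z) n (h : (n <= l.+1)%N) :
  mor_conflation i p -> conflation (aug_ladder i n h) (aug_ladder p n h).
Proof.
move=> c; case: n h => [|n] h /=; last exact: c.
(* At index 0 all three terms are the zero object, whose identity is the zero morphism. *)
by have := zero_conf_l (E := E) zero_ob zero_obP; rewrite zero_obP.
Qed.

Lemma chain_comp_aug X i j (hi : (i.+1 <= l.+1)%N) (hj : (j.+1 <= l.+1)%N) :
  (i <= j)%N -> chain_comp (aug X) hi hj = @chain_comp E l X i hi j hj.
Proof.
elim: j hj => [|j IH] hj; rewrite leq_eqVlt => /orP[/eqP e|ij //].
- by case: _ / e in hj *; rewrite (bool_irrelevance hj hi) !chain_comp_id.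
- by case: _ / e in hj *; rewrite (bool_irrelevance hj hi) !chain_comp_id.
- by rewrite chain_compS // IH //=; apply: chain_comp_trans.
Qed.

Lemma chain_comp_aug_map X k (h : (k < l)%N) :
  @chain_comp E l.+1 (aug X) k.+1 (ltnW h) k.+2 h = chain_map X h.
Proof. by rewrite chain_comp_aug // chain_comp_map. Qed.

End Augmentation.

(** * Reindexing of chains along monotone maps *)

Section Reindex.
Variables (E : exactcat) (l l' : nat) (phi : nat -> nat).
Hypothesis phi_mono : forall k, (phi k <= phi k.+1)%N.
Hypothesis phi_bound : forall k, (k <= l)%N -> (phi k <= l')%N.
Implicit Types X Y : mchain E l'.

Definition reindex X : mchain E l :=
  @MChain E l (fun k h => X (phi k) (phi_bound h))
    (fun k h => chain_comp X (phi_bound (ltnW h)) (phi_bound h))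
    (fun k h => chain_comp_inflation X _ _ (phi_mono k)).

Definition reindex_ladder X Y (f : ladder X Y) : ladder (reindex X) (reindex Y) :=
  @Ladder E l (reindex X) (reindex Y) (fun k h => f (phi k) (phi_bound h))
    (fun k h => chain_comp_natural f _ _ (phi_mono k)).

End Reindex.

(** * Natural maps between a chain and its reindexed version *)

Section Comparison.
Variables (E : exactcat) (l : nat) (phi : nat -> nat).
Hypothesis phi_mono : forall k, (phi k <= phi k.+1)%N.
Hypothesis phi_bound : forall k, (k <= l)%N -> (phi k <= l.+1)%N.
Implicit Types X Y : mchain E l.

(** The values of [phi] are augmented indices: 0 selects the zero object, and [phi k = k.+1] leaves
    the term at [k] in place. *)
Definition resample X : mchain E l := reindex phi_mono phi_bound (aug X).

Definition resample_ladder X Y (f : ladder X Y) : ladder (resample X) (resample Y) :=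
  reindex_ladder phi_mono phi_bound (aug_ladder f).

Section Counit.
Hypothesis phi_le : forall k, (phi k <= k.+1)%N.

Definition counit_map X k (h : (k <= l)%N) : resample X k h ~> X k h :=
  @chain_comp E l.+1 (aug X) (phi k) (phi_bound h) k.+1 h.

Lemma counit_comm X k (h : (k < l)%N) :
  chain_map X h ∘ counit_map X (ltnW h) = counit_map X h ∘ chain_map (resample X) h.
Proof.
(* Both sides are the composite in the augmented chain from [phi k] to [k.+2]. *)
rewrite -(chain_comp_aug_map X) /counit_map /=.
rewrite (@chain_comp_trans E l.+1 (aug X) (phi k) k.+1 k.+2) //.
by rewrite (@chain_comp_trans E l.+1 (aug X) (phi k) (phi k.+1) k.+2).
Qed.

Definition resample_counit X : ladder (resample X) X := Ladder (@counit_comm X).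

Lemma counit_natural X Y (f : ladder X Y) k (h : (k <= l)%N) :
  f k h ∘ resample_counit X k h = resample_counit Y k h ∘ resample_ladder f k h.
Proof.
exact/esym/(@chain_comp_natural E l.+1 _ _ (aug_ladder f) (phi k) k.+1 (phi_bound h) h).
Qed.
End Counit.

Section Unit.
Hypothesis phi_ge : forall k, (k < phi k)%N.

Definition unit_map X k (h : (k <= l)%N) : X k h ~> resample X k h :=
  @chain_comp E l.+1 (aug X) k.+1 h (phi k) (phi_bound h).

Lemma unit_comm X k (h : (k < l)%N) :
  chain_map (resample X) h ∘ unit_map X (ltnW h) = unit_map X h ∘ chain_map X h.
Proof.
rewrite -(chain_comp_aug_map X) /unit_map /=.
rewrite (@chain_comp_trans E l.+1 (aug X) k.+1 (phi k) (phi k.+1)) //.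
by rewrite (@chain_comp_trans E l.+1 (aug X) k.+1 k.+2 (phi k.+1)).
Qed.

Definition resample_unit X : ladder X (resample X) := Ladder (@unit_comm X).

Lemma unit_natural X Y (f : ladder X Y) k (h : (k <= l)%N) :
  resample_ladder f k h ∘ resample_unit X k h = resample_unit Y k h ∘ f k h.
Proof.
exact/esym/(@chain_comp_natural E l.+1 _ _ (aug_ladder f) k.+1 (phi k) h (phi_bound h)).
Qed.
End Unit.

End Comparison.

(** * Termwise detection of stable isomorphisms of chains *)

Section StableChains.
Variables (F : frobcat) (l : nat).
Local Notation M := (stab_add (mor_frob F l)).
Implicit Types X Y Z : mchain F l.

Definition lcl X Y (f : ladder X Y) : (X : M) ~> (Y : M) :=
  @scl (mor_frob F l) X Y f.

Lemma lcl_comp X Y Z (g : ladder Y Z) (f : ladder X Y) :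
  lcl g ∘ lcl f = lcl (ladder_comp g f).
Proof. exact: (@scl_comp (mor_frob F l) X Y Z g f). Qed.

Lemma lcl_surj X Y (f : (X : M) ~> (Y : M)) : exists f0 : ladder X Y, f = lcl f0.
Proof. exact: (@scl_surj (mor_frob F l) X Y f). Qed.

Lemma is_zero_chain X :
  is_zero (X : M) <-> forall k (h : (k <= l)%N), projective (X k h).
Proof.
split=> [/(is_zero_projective (F := mor_frob F l)) hX | hX].
  exact: mor_projective_term.
exact/(is_zero_projective (F := mor_frob F l))/projective_chain.
Qed.

(** Evaluation at an index sends projective chains to projective objects, so it descends to the
    stable categories. *)
Lemma lcl_term X Y (f g : ladder X Y) k (h : (k <= l)%N) :
  lcl f = lcl g -> scl (f k h) = scl (g k h).
Proof.
move=> /(@scl_eq (mor_frob F l)) [P [u [v [hP e]]]]; apply/scl_eq.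
exists ((P : mchain F l) k h), ((u : ladder X P) k h), ((v : ladder P Y) k h).
split; first exact: mor_projective_term.
exact: (ladder_eq h e).
Qed.

Lemma lcl_iso_term X Y (f : ladder X Y) k (h : (k <= l)%N) :
  is_iso (lcl f) -> is_iso (scl (f k h)).
Proof.
move=> [g' [gl gr]]; have [g eg] := lcl_surj g'; rewrite {g'}eg !lcl_comp in gl gr.
exists (scl (g k h)); split; rewrite scl_comp.
  exact: (@lcl_term X X (ladder_comp g f) (ladder_id X) k h gl).
exact: (@lcl_term Y Y (ladder_comp f g) (ladder_id Y) k h gr).
Qed.

Lemma lcl_term_iso X Y (f : ladder X Y) :
  (forall k (h : (k <= l)%N), is_iso (scl (f k h))) -> is_iso (lcl f).
Proof.
move=> hf; have [Y' [Z [j [i [p [v [w [c ij e t]]]]]]]] :=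
  @cone_conflation (mor_frob F l) X Y f.
apply: (dist_zero_iso t); apply/is_zero_chain => k h.
(* Stably [i] is [f] followed by the isomorphism [j], so each term of [i] is stably invertible and
   has projective cokernel. *)
apply/is_zero_projective/(conf_infl_iso_zero (c k h)).
rewrite -(@lcl_term X Y' (ladder_comp j f) i k h); last by rewrite -lcl_comp.
by rewrite -scl_comp; apply: is_iso_comp (hf k h) _; apply: lcl_iso_term.
Qed.

End StableChains.

(** * Stably constant chains and chains with prescribed projective terms *)

Section Decompositions.
Variables (F : frobcat) (l : nat).
Local Notation M := (stab_add (mor_frob F l)).
Implicit Types X Y Z : mchain F l.

(** Here [a] and [b] are augmented indices; for [a = 0] the condition forces the augmented terms up
    to [b] to be stably zero. *)
Definition stably_const a b X := forall n (h : (n < l.+1)%N), (a <= n < b)%N ->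
  is_iso (scl (chain_map (aug X) h)).

Definition projective_at (P : pred nat) X := forall n (h : (n <= l.+1)%N), P n ->
  projective (aug X n h).

Lemma stably_const_comp a b X i j (hi : (i <= l.+1)%N) (hj : (j <= l.+1)%N) :
  stably_const a b X -> (a <= i)%N -> (i <= j)%N -> (j <= b)%N ->
  is_iso (scl (chain_comp (aug X) hi hj)).
Proof.
move=> hX ai; elim: j hj => [|j IH] hj; rewrite leq_eqVlt => /orP[/eqP e|ij //] jb.
- by case: _ / e in hj *; rewrite (bool_irrelevance hj hi) chain_comp_id scl_id; apply: is_iso_id.
- by case: _ / e in hj *; rewrite (bool_irrelevance hj hi) chain_comp_id scl_id; apply: is_iso_id.
rewrite chain_compS // -scl_comp; apply: is_iso_comp; first exact: (IH _ ij (ltnW jb)).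
by apply: hX; rewrite jb (leq_trans ai).
Qed.

Lemma projective_zero_ob : projective (zero_ob F).
Proof. by apply/is_zero_projective; rewrite /is_zero -scl_id zero_obP scl0. Qed.

Lemma stably_zero_ob : is_zero (zero_ob F : stab_add F).
Proof. exact/is_zero_projective/projective_zero_ob. Qed.

Lemma aug_iso X Y (f : ladder X Y) n (h : (n <= l.+1)%N) :
  is_iso (lcl f) -> is_iso (scl (aug_ladder f n h)).
Proof.
case: n h => [|n] h hf; last exact: (@lcl_iso_term F l X Y f n h hf).
by rewrite /= scl0; apply: zero_iso; exact: stably_zero_ob.
Qed.

(** This passes between the two proofs of the bound that occur in [aug_map] and in [chain_map]. *)
Lemma aug_map_iso X k (h : (k < l)%N) :
  is_iso (scl (@chain_map F l.+1 (aug X) k.+1 h)) <-> is_iso (scl (chain_map X h)).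
Proof.
have e (h1 h2 : (k <= l)%N) (h3 : (k.+1 <= l)%N) :
    is_iso (scl (chain_comp X h1 h3)) <-> is_iso (scl (chain_comp X h2 h3)).
  by rewrite (bool_irrelevance h1 h2).
by rewrite -(chain_comp_map X h); exact: e.
Qed.

(** The maps from index [n] to [n.+1] form a morphism of conflations; if two of its three components
    are stable isomorphisms, so is the third. *)
Lemma stably_const_triangulated a b :
  @triangulated_subcategory (stable_mono F l) (stably_const a b).
Proof.
apply: (@triangulated_subcategory_conf (mor_frob F l)).
- move=> X Y [g ig] hX n h hn; have [f ef] := @lcl_surj F l X Y g; subst g.
  apply: (iso_conj (aug_iso (ltnW h) ig) (aug_iso h ig) _ (hX n h hn)).
  by rewrite !scl_comp ladder_comm.
- move=> X /mor_projective_term hX n h hn.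
  suff zX k (hk : (k <= l.+1)%N) : is_zero (aug X k hk : stab_add F).
    by rewrite [scl _](zero_from _ (zX _ _)); apply: zero_iso.
  apply/is_zero_projective; case: k hk => [|k] hk; last exact: hX.
  exact: projective_zero_ob.
- move=> X Y Z i p c hX hY n h hn.
  apply: (conf_five_coker (aug_conflation (ltnW h) c) (aug_conflation h c) _ _
    (hX n h hn) (hY n h hn)); exact: ladder_comm.
- move=> X Y Z i p c hY hZ n h hn.
  apply: (conf_five_ker (aug_conflation (ltnW h) c) (aug_conflation h c) _ _
    (hY n h hn) (hZ n h hn)); exact: ladder_comm.
Qed.

Lemma projective_at_triangulated P :
  @triangulated_subcategory (stable_mono F l) (projective_at P).
Proof.
apply: (@triangulated_subcategory_conf (mor_frob F l)).
- move=> X Y [g ig] hX n h hn; have [f ef] := @lcl_surj F l X Y g; subst g.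
  have [g [_ e]] := aug_iso h ig.
  apply/is_zero_projective; rewrite /is_zero -e.
  have /is_zero_projective zX := hX n h hn.
  by rewrite [g](zero_to _ zX) comp0r.
- move=> X /mor_projective_term hX [|n] h _; first exact: projective_zero_ob.
  exact: hX.
- move=> X Y Z i p c hX hY n h hn.
  exact: (conf_projective_coker (aug_conflation h c) (hX n h hn) (hY n h hn)).
- move=> X Y Z i p c hY hZ n h hn.
  exact: (conf_projective_ker (aug_conflation h c) (hY n h hn) (hZ n h hn)).
Qed.

Lemma resample_zero phi m b (P : pred nat) X : projective_at P X ->
  (forall k, P (phi k)) -> is_zero (@resample F l phi m b X : M).
Proof. by move=> hX hP; apply/is_zero_chain => k h; apply: hX. Qed.

Lemma is_identity_scl_iso (X Y : F) (f : X ~> Y) : is_identity f -> is_iso (scl f).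
Proof. by case; exact: is_iso_id. Qed.

Lemma chain_comp_scl_iso n (X : mchain F n) i j (hi : (i <= n)%N) (hj : (j <= n)%N) :
  i = j -> is_iso (scl (chain_comp X hi hj)).
Proof. by move=> e; case: (chain_comp_is_identity X hi hj e); exact: is_iso_id. Qed.

(** * The two decompositions attached to an interval *)

Section Interval.
Variables a b : nat.
Hypotheses (ab : (a <= b)%N) (bl : (b <= l.+1)%N).

Definition collapse_down k := if (a <= k.+1 <= b)%N then a else k.+1.
Definition collapse_up k := if (a <= k.+1 <= b)%N then b else k.+1.

Lemma collapse_down_mono k : (collapse_down k <= collapse_down k.+1)%N.
Proof. by rewrite /collapse_down; case: ifP; case: ifP; lia. Qed.

Lemma collapse_down_bound k : (k <= l)%N -> (collapse_down k <= l.+1)%N.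
Proof. by rewrite /collapse_down; case: ifP; lia. Qed.

Lemma collapse_down_le k : (collapse_down k <= k.+1)%N.
Proof. by rewrite /collapse_down; case: ifP; lia. Qed.

Lemma collapse_up_mono k : (collapse_up k <= collapse_up k.+1)%N.
Proof. by rewrite /collapse_up; case: ifP; case: ifP; lia. Qed.

Lemma collapse_up_bound k : (k <= l)%N -> (collapse_up k <= l.+1)%N.
Proof. by rewrite /collapse_up; case: ifP; lia. Qed.

Lemma collapse_up_ge k : (k < collapse_up k)%N.
Proof. by rewrite /collapse_up; case: ifP; lia. Qed.

Local Notation down := (resample collapse_down_mono collapse_down_bound).
Local Notation up := (resample collapse_up_mono collapse_up_bound).
Local Notation eps := (resample_counit collapse_down_mono collapse_down_bound collapse_down_le).
Local Notation eta := (resample_unit collapse_up_mono collapse_up_bound collapse_up_ge).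

Lemma counit_iso X : stably_const a b X -> is_iso (lcl (eps X)).
Proof.
move=> hX; apply: lcl_term_iso => k h /=.
have := collapse_down_le k; rewrite /counit_map.
(* The source of the map depends on [collapse_down k], so the proofs about it are generalised before
   the case split. *)
move: (collapse_down_bound h); rewrite /collapse_down.
case: ifP => [/andP[h1 h2]|_] h3 h4; last first.
  exact: (@chain_comp_scl_iso l.+1 (aug X) k.+1 k.+1 h3 h erefl).
exact: (@stably_const_comp a b X a k.+1 h3 h hX).
Qed.

Lemma unit_iso X : stably_const a b X -> is_iso (lcl (eta X)).
Proof.
move=> hX; apply: lcl_term_iso => k h /=.
have := collapse_up_ge k; rewrite /unit_map.
move: (collapse_up_bound h); rewrite /collapse_up.
case: ifP => [/andP[h1 h2]|_] h3 h4; last first.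
  exact: (@chain_comp_scl_iso l.+1 (aug X) k.+1 k.+1 h h3 erefl).
exact: (@stably_const_comp a b X k.+1 b h h3 hX).
Qed.

Lemma counit_iso_off X k (h : (k <= l)%N) : ~~ (a < k.+1 <= b)%N ->
  is_iso (scl (eps X k h)).
Proof.
move=> hk; apply: (@chain_comp_scl_iso l.+1 (aug X) (collapse_down k) k.+1 _ h).
by rewrite /collapse_down; case: ifP; lia.
Qed.

Lemma unit_iso_off X k (h : (k <= l)%N) : ~~ (a <= k.+1 < b)%N ->
  is_iso (scl (eta X k h)).
Proof.
move=> hk; apply: (@chain_comp_scl_iso l.+1 (aug X) k.+1 (collapse_up k) h).
by rewrite /collapse_up; case: ifP; lia.
Qed.

Lemma down_stably_const X : stably_const a b (down X).
Proof.
move=> [|n] h hn.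
  (* Index 0 occurs only when [a = 0 < b]; the first term of [down X] is then the added zero
     object. *)
  have e : collapse_down 0 = 0%N by rewrite /collapse_down; case: ifP; lia.
  rewrite [chain_map _ _]/= scl0; apply: zero_iso; first exact: stably_zero_ob.
  rewrite /=; move: (collapse_down_bound _); rewrite e => ?.
  exact: stably_zero_ob.
apply/aug_map_iso.
apply: (@chain_comp_scl_iso l.+1 (aug X) (collapse_down n) (collapse_down n.+1)).
by rewrite /collapse_down; do 2 case: ifP; lia.
Qed.

Lemma up_is_identity X k (h : (k < l)%N) : (a <= k.+1 < b)%N ->
  is_identity (chain_map (up X) h).
Proof.
move=> hk; apply: (@chain_comp_is_identity F l.+1 (aug X) (collapse_up k) (collapse_up k.+1)).
by rewrite /collapse_up; do 2 case: ifP; lia.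
Qed.

Lemma semiorthogonal_const_projective :
  @semiorthogonal_decomposition (stable_mono F l) (stably_const a b)
    (projective_at (fun n => ~~ (a < n <= b)%N)).
Proof.
split.
- exact: stably_const_triangulated.
- exact: projective_at_triangulated.
- move=> X Y f hX hY; have [f0 ->] := @lcl_surj F l X Y f.
  have zY : is_zero (down Y : M).
    (* No value of [collapse_down] lies in ]a, b], so only projective terms of [Y] survive. *)
    by apply: resample_zero hY _ => k; rewrite /collapse_down; case: ifP; lia.
  have e : lcl f0 ∘ lcl (eps X) = 0.
    rewrite lcl_comp.
    have -> : ladder_comp f0 (eps X) =
        ladder_comp (eps Y) (resample_ladder collapse_down_mono collapse_down_bound f0).
      by apply: ladder_ext => k h; exact: counit_natural.
    by rewrite -lcl_comp [lcl (resample_ladder _ _ _)](zero_to _ zY) comp0r.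
  have [g [_ gr]] := counit_iso hX.
  by rewrite -[LHS]compm1 -gr -compmA e comp0l.
- move=> X; have [X' [V [j [i [p [v [w [c ij e t]]]]]]]] :=
    @cone_conflation (mor_frob F l) _ _ (eps X).
  exists (down X), V, (lcl (eps X)), v, w; split=> //; first exact: down_stably_const.
  move=> [|k] h hk; first exact: projective_zero_ob.
  (* Outside ]a, b] the counit is stably invertible, and [j] is so everywhere; hence [i] is too, and
     its cokernel is projective. *)
  apply/is_zero_projective/(conf_infl_iso_zero (c k h)).
  rewrite -(@lcl_term F l (down X) X' (ladder_comp j (eps X)) i k h); last first.
    by rewrite -lcl_comp.
  rewrite -scl_comp; apply: is_iso_comp (counit_iso_off X h hk) _.
  exact: lcl_iso_term.
Qed.

Lemma semiorthogonal_projective_const : (0 < a)%N ->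
  @semiorthogonal_decomposition (stable_mono F l)
    (projective_at (fun n => ~~ (a <= n < b)%N)) (stably_const a b).
Proof.
move=> a0; split.
- exact: projective_at_triangulated.
- exact: stably_const_triangulated.
- move=> X Y f hX hY; have [f0 ->] := @lcl_surj F l X Y f.
  have zX : is_zero (up X : M).
    (* Likewise, no value of [collapse_up] lies in [a, b[. *)
    by apply: resample_zero hX _ => k; rewrite /collapse_up; case: ifP; lia.
  apply: (iso_mono0 (unit_iso hY)); rewrite lcl_comp.
  have -> : ladder_comp (eta Y) f0 =
      ladder_comp (resample_ladder collapse_up_mono collapse_up_bound f0) (eta X).
    by apply: ladder_ext => k h; exact/esym/unit_natural.
  by rewrite -lcl_comp [lcl (eta X)](zero_to _ zX) comp0r.
- move=> X; have [X' [U [j [i [p [u [w [c ij e t]]]]]]]] :=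
    @cocone_conflation (mor_frob F l) _ _ (eta X).
  exists U, (up X), u, (lcl (eta X)), w; split=> //.
    move=> [|k] h hk; first exact: projective_zero_ob.
    apply/is_zero_projective/(conf_defl_iso_zero (c k h)).
    (* Stably [p] after [j] is the unit, which is invertible outside [a, b[; cancelling [j] makes
       [p] invertible there. *)
    apply: (@iso_cancel_r (stab_add F) _ _ _ (scl ((p : ladder _ _) k h)) _
      (@lcl_iso_term F l X X' j k h ij)).
    rewrite scl_comp (@lcl_term F l X (up X) (ladder_comp p j) (eta X) k h); last first.
      by rewrite -lcl_comp.
    exact: unit_iso_off.
  (* By [0 < a] the interval avoids the added zero term, which [up] does not replace. *)
  case=> [|n] h hn; first by lia.
  exact/aug_map_iso/is_identity_scl_iso/up_is_identity.
Qed.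

(** The predecessors convert augmented indices into positions of the chain. Conversely, the unit
    identifies a stably constant chain with [up X], whose maps on the interval are identities. *)
Lemma Delta_stably_const : (0 < a)%N ->
  (Delta F l a.-1 b.-1 : mchain F l -> Prop) = stably_const a b.
Proof.
move=> a0; apply/funext => X; apply/propext; split=> [[Y [iXY hY]] | hX].
  have [_ closed _ _] := stably_const_triangulated a b.
  apply: (closed Y); first by have [f [g fg]] := iXY; exists g, f; apply: inverse_sym.
  case=> [|k] h hk; first by lia.
  by apply/aug_map_iso/is_identity_scl_iso/hY; lia.
exists (up X); split; first by exists (lcl (eta X)); exact: unit_iso.
by move=> k h hk; apply: up_is_identity; lia.
Qed.

End Interval.

Lemma Gamma_projective_at s t (P : pred nat) :
  (forall k, (k <= l)%N -> P k.+1 = (k < s)%N || (t < k)%N) ->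
  (Gamma F l s t : mchain F l -> Prop) = projective_at P.
Proof.
move=> hP; apply/funext => X; apply/propext; split=> hX.
  (* At index 0 the predicate [P] is unconstrained, but the added zero term is always projective. *)
  move=> [|k] h hk; first exact: projective_zero_ob.
  by apply: hX; rewrite -hP.
by move=> k h hk; apply: (hX k.+1 h); rewrite hP.
Qed.

(** The augmented chain starts at the zero object, so its first maps are stable isomorphisms exactly
    when the terms they reach are stably zero, that is, projective. *)
Lemma Gamma_stably_const s : (s <= l)%N ->
  (Gamma F l s.+1 l : mchain F l -> Prop) = stably_const 0 s.+1.
Proof.
move=> hs; apply/funext => X; apply/propext.
have zO := stably_zero_ob; split=> hX.
  have zX n (h : (n <= l.+1)%N) : (n <= s.+1)%N -> is_zero (aug X n h : stab_add F).
    case: n h => [|n] h hn //; apply/is_zero_projective/hX; lia.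
  move=> n h hn; rewrite [scl _](zero_from _ (zX _ _ _)); try lia.
  by apply: zero_iso; apply: zX; lia.
move=> k h hk; apply/is_zero_projective.
have h0 : (0 <= l.+1)%N by [].
have [|g [_ e]] := @stably_const_comp 0 s.+1 X 0 k.+1 h0 h hX (leq0n _) (leq0n _).
  by lia.
by rewrite /is_zero -e [g](zero_to _ zO) comp0r.
Qed.

End Decompositions.

Unset Implicit Arguments.

Theorem theorem1 (F : frobcat) (l s t : nat)
    (hs : (s <= l)%N) (ht : (t <= l)%N) :
  ((s < l)%N ->
     semiorthogonal_decomposition (Gamma F l s.+1 l) (Gamma F l 0 s)) /\
  ((s <= t)%N -> (t < l)%N ->
     semiorthogonal_decomposition (Gamma F l s t) (Delta F l s t.+1)) /\
  ((0 < s)%N -> (s <= t)%N ->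
     semiorthogonal_decomposition (Delta F l s.-1 t) (Gamma F l s t)).
Proof.
split=> [sl|]; last split=> [st tl|s0 st].
(* The augmented interval is [0, s + 1], starting at the added zero object. *)
- rewrite Gamma_stably_const // (@Gamma_projective_at F l 0 s (fun n => ~~ (0 < n <= s.+1)%N)).
    by apply: semiorthogonal_const_projective; lia.
  by move=> k _ /=; lia.
(* The augmented interval is [s + 1, t + 2], that is, positions s to t + 1 of the chain. *)
- rewrite (@Delta_stably_const F l s.+1 t.+2) //; try lia.
  rewrite (@Gamma_projective_at F l s t (fun n => ~~ (s.+1 <= n < t.+2)%N)).
    by apply: semiorthogonal_projective_const; lia.
  by move=> k _ /=; lia.
(* The augmented interval is [s, t + 1], that is, positions s - 1 to t of the chain. *)
- rewrite (@Delta_stably_const F l s t.+1) //; try lia.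
  rewrite (@Gamma_projective_at F l s t (fun n => ~~ (s < n <= t.+1)%N)).
    by apply: semiorthogonal_const_projective; lia.
  by move=> k _ /=; lia.
Qed.
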